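(* Let $q=2^h$, let $t<h$ be the largest proper divisor of $h$ (so $h\ge 2$), and let $C$ be a linear $(n,k+1,q)$-MDS code over $GF(q)$ with $n>q-2^{h-t}+k-1$. Let $S$ be the collection of codes consisting of $C$ and all (linear or non-linear) extensions of $C$. Then: (i) all members of $S$ are LE codes; (ii) there is, up to equivalence, a unique maximal code in $S$.
   Context: An $(n,k,q)$-MDS code over an alphabet $\mathcal A$ of size $q$ is a set of $q^k$ $n$-tuples (words) over $\mathcal A$ such that no two distinct words agree in $k$ or more coordinate positions. It is linear if $\mathcal A=GF(q)$ and the code is a $k$-dimensional subspace of $GF(q)^n$. An $(m,k,q)$-MDS code $C'$ with $m>n$ (over the same alphabet) is an extension of the $(n,k,q)$-MDS code $C$ if deleting some fixed set of $m-n$ coordinate positions from every word of $C'$ yields $C$. An MDS code is maximal if it admits no extensions. Two codes of length $n$ over $\mathcal A$, viewed as matrices whose rows are the words, are equivalent if one is obtained from the other by a sequence of operations of the types: permuting rows; permuting columns; applying a permutation of the alphabet entrywise to a single column. A code is an LE code if it is equivalent to a linear code.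
   Formalization: The formal theorem assumes k ≥ 1; for k = 0 a linear (n,1,q)-MDS code (e.g. all words (a,a) over GF(4)) can always be extended by repeating a column, so S has no maximal code and (ii) fails. *)

(* Defs.v *)
From Stdlib Require Import Relations.
From mathcomp Require Import all_boot all_order all_fingroup all_algebra.
Set Implicit Arguments.
Unset Strict Implicit.
Unset Printing Implicit Defensive.

(* The length is a field so that codes of different lengths, such as a code
   and its extensions, live in one type. *)
Record code (A : finType) := Code { len : nat; words : {set 'rV[A]_len} }.

Definition agree (A : finType) (n : nat) (u v : 'rV[A]_n) : {set 'I_n} :=
  [set i | u ord0 i == v ord0 i].

Definition is_MDS (A : finType) (n k q : nat) (C : code A) : Prop :=
  [/\ #|A| = q, len C = n, #|words C| = q ^ k
    & forall u v, u \in words C -> v \in words C -> u != v ->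
        ~~ (k <= #|agree u v|)].

Definition is_linear_MDS (F : finFieldType) (n k q : nat) (C : code F) : Prop :=
  is_MDS n k q C /\
  exists U : {vspace 'rV[F]_(len C)},
    \dim U = k /\ words C = [set v | v \in U].

(* Deleting a set D of positions amounts to reading off the positions outside
   D in increasing order; keep enumerates those positions, and the number of
   deleted ones is then len C' - len C. *)
Definition extension (A : finType) (k q : nat) (C' C : code A) : Prop :=
  [/\ is_MDS (len C) k q C, is_MDS (len C') k q C', len C < len C'
    & exists keep : 'I_(len C) -> 'I_(len C'),
        (forall i j : 'I_(len C), i < j -> keep i < keep j) /\
        words C = [set colsub keep w | w in words C']].

Definition maximal (A : finType) (k q : nat) (C : code A) : Prop :=
  is_MDS (len C) k q C /\ forall C' : code A, ~ extension k q C' C.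

Definition permute_entry (A : finType) (n : nat) (j : 'I_n) (p : {perm A})
    (w : 'rV[A]_n) : 'rV[A]_n :=
  \row_i (if i == j then p (w ord0 i) else w ord0 i).

(* Permuting the rows of the matrix of words needs no constructor: it leaves
   the set of words unchanged. *)
Inductive code_step (A : finType) : code A -> code A -> Prop :=
| permute_columns (n : nat) (W : {set 'rV[A]_n}) (s : 'S_n) :
    code_step (Code W) (Code [set col_perm s w | w in W])
| permute_alphabet (n : nat) (W : {set 'rV[A]_n}) (j : 'I_n) (p : {perm A}) :
    code_step (Code W) (Code [set permute_entry j p w | w in W]).

Definition equivalent (A : finType) : code A -> code A -> Prop :=
  clos_refl_trans (code A) (@code_step A).

Definition is_LE (F : finFieldType) (k q : nat) (C : code F) : Prop :=
  exists L : code F, is_linear_MDS (len L) k q L /\ equivalent L C.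

Definition self_or_extension (A : finType) (k q : nat) (C D : code A) : Prop :=
  D = C \/ extension k q D C.

Definition largest_proper_divisor (h t : nat) : Prop :=
  [/\ t %| h, t < h & forall d, d %| h -> d < h -> d <= t].

(* Main.v *)
From Stdlib Require Import Relations.
Require Import Defs.
From mathcomp Require Import all_boot all_order all_fingroup all_algebra.
From mathcomp Require Import finfield.
From mathcomp Require Import zify ring.
Set Implicit Arguments.
Unset Strict Implicit.
Unset Printing Implicit Defensive.
Import GRing.Theory.
Local Open Scope ring_scope.

(** A linear (n, K, q)-MDS code, here with K = k + 1, is the set of words
    (w . P_1, ..., w . P_n), where w runs over GF(q)^K and any K of the points
    P_j are linearly independent: the P_j form an arc.  Every other coordinate
    of an extension of the code is a function phi of w, and two facts about
    such functions carry the theorem.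

    1. phi is a linear functional followed by a permutation of the alphabet
       ([extra_column_linear]).  Restrict phi to an affine plane on which K - 2
       basis coordinates are constant.  A level set of phi meets every line
       along which one of the remaining n - K + 2 coordinates is constant in one
       point, so it is the graph of a function that determines at most 2^(h-t)
       directions.  Such a function is affine ([few_directions_affine]);
       the level sets are therefore parallel lines.  The slopes obtained in
       parallel planes agree, since otherwise a slope would depend on the base
       point by a nonconstant affine function and would vanish somewhere,
       against the injectivity of phi along lines.

       The statement on directions is proved with the Redei polynomial, the
       product of the X - (f x - x Y).  If f determines N directions, the
       coefficients of X^i with N < i < q vanish.  As N is at most q / 2, a
       divisibility argument shows that at a determined direction the derivative
       in X vanishes, so that this derivative, as a polynomial in X and Y, is
       constant in X.  Evaluating it at the roots shows that all the lines of a
       given direction that meet the graph do so in the same number of points,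
       a power of 2.  If s is the smallest such number, for a direction where it
       occurs the product of the distinct factors is a lacunary
       polynomial that splits, and this forces GF(s) to be a subfield and N to
       be at least q / s ([lacunary_subfield]).  By maximality of t equality
       holds, which contradicts a count of the points modulo s.

    2. If two nonproportional points both extend a large arc, then so does the
       pair ([extends_pair]).  Otherwise, projecting from K - 3 points of the
       arc gives an arc of the affine plane that misses the directions of three
       points at infinity.  In even characteristic this bounds the
       size of the arc by q / 2 ([no_arc_three_free_directions]): products of
       tangents at a and evaluated at b are symmetric in a and b, up to factors
       depending on a or b alone, so that a double sum of interpolation weights
       cancels in pairs, whereas partial fractions compute it to be 1.

    By the first fact every extension is a linear code up to permutations of the
    alphabet in each column.  By the second one, the points that extend the arc
    can all be added together, so a maximal extension contains each of them
    exactly once up to a scalar; two maximal extensions then differ by a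
    permutation of the columns and by permutations of the alphabet. *)

(** * The Redei polynomial of a function *)

Lemma natr_card0 (F : finFieldType) : #|F|%:R = 0 :> F.
Proof.
apply: (addrI (\sum_x x)); rewrite addr0 -sumr_const -big_split /=.
by rewrite [RHS](reindex_inj (addIr 1)).
Qed.

Section Directions.

Variables (F : finFieldType) (f : F -> F).
Local Notation q := #|F|.

Definition redei_at (y : F) : {poly F} := \prod_x ('X - (f x - x * y)%:P).

(** Univariate in X over the ring of polynomials in the slope Y. *)
Definition redei : {poly {poly F}} := \prod_x ('X - ((f x)%:P - x *: 'X)%:P).

(** The directions y of the chords of the graph of f: those for which the
    intercept f x - x * y repeats. *)
Definition determined : {set F} :=
  [set y | ~~ injectiveb (fun x => f x - x * y)].

Lemma coef_redei_at y i : (redei_at y)`_i = (redei`_i).[y].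
Proof.
suff -> : redei_at y = map_poly (horner_eval y) redei by rewrite coef_map.
rewrite rmorph_prod; apply: eq_bigr => x _ /=.
by rewrite map_polyXsubC /= /horner_eval !hornerE.
Qed.

(** Each factor has total degree at most 1, so that the coefficient of X^i
    in a product of n factors has degree at most n - i. *)
Lemma size_coef_prod_lines (I : Type) (s : seq I) (l : I -> {poly F}) i :
  (forall x, size (l x) <= 2)%N -> (i <= size s)%N ->
  (size ((\prod_(x <- s) ('X - (l x)%:P))`_i)%R <= (size s - i).+1)%N.
Proof.
move=> sl; elim: s i => [|x s IH] i /=.
  by rewrite big_nil leqn0 => /eqP ->; rewrite coef1 size_poly1.
move=> le_i; rewrite big_cons mulrBl coefB coefXM coefCM.
apply: leq_trans (size_polyD _ _) _; rewrite size_polyN geq_max; apply/andP; split.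
  case: i le_i => [|i] le_i /=; first by rewrite size_poly0.
  by rewrite subSS; apply: IH.
have [lt_si|le_is] := ltnP (size s) i.
  by rewrite nth_default ?mulr0 ?size_poly0 // size_prod_XsubC.
apply: leq_trans (size_polyMleq _ _) _.
by rewrite subSn // -!subn1 (leq_sub2r 1 (leq_add (sl x) (IH _ le_is))).
Qed.

Lemma size_coef_redei i : (i <= q)%N -> (size (redei`_i)%R <= (q - i).+1)%N.
Proof.
rewrite cardT enumT => le_i; apply: size_coef_prod_lines => // x.
apply: leq_trans (size_polyD _ _) _.
rewrite size_polyN geq_max (leq_trans (size_polyC_leq1 _)) //=.
by apply: leq_trans (size_scale_leq _ _) _; rewrite size_polyX.
Qed.

Lemma size_redei_at y : size (redei_at y) = q.+1.
Proof. by rewrite size_prod_XsubC cardT enumT. Qed.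

Lemma size_redei : size redei = q.+1.
Proof. by rewrite size_prod_XsubC cardT enumT. Qed.

Lemma redei_at_monic y : redei_at y \is monic.
Proof. exact: monic_prod_XsubC. Qed.

Lemma redei_at_undetermined y : y \notin determined -> redei_at y = 'X^q - 'X.
Proof.
rewrite inE negbK => /injectiveP inj_fy.
rewrite finField_genPoly /redei_at [RHS](reindex (fun x => f x - x * y)) //.
by apply: onW_bij; apply: injF_bij.
Qed.

(** By the Leibniz rule the derivative is a sum of products that lack one linear
    factor each, and that factor divides X^q - X. *)
Lemma prod_XsubC_dvd_deriv (s : seq F) :
  let P := \prod_(a <- s) ('X - a%:P) in P %| ('X^q - 'X) * P^`().
Proof.
elim: s => [|a s IH] /=; first by rewrite big_nil dvd1p.
rewrite big_cons derivM derivXsubC mul1r mulrDr dvdp_add //.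
  rewrite dvdp_mul // dvdp_XsubCl /root !hornerE.
  by rewrite expf_card subrr.
by rewrite mulrCA dvdp_mul2l // polyXsubC_eq0.
Qed.

Variable h : nat.
Hypotheses (h_gt0 : (0 < h)%N) (cardF : q = (2 ^ h)%N).

Lemma pchar2 : 2 \in [pchar F].
Proof. exact: card_finPcharP cardF _. Qed.

Lemma deriv_XnCard : ('X^q : {poly F})^`() = 0.
Proof. by rewrite derivXn -mulr_natr -polyC_natr natr_card0 mulr0. Qed.

(** The coefficient of X^i has degree at most q - i in the slope, and vanishes
    at every direction that is not determined. *)
Lemma redei_gap i :
  (1 < i)%N -> (#|determined| < i < q)%N -> redei`_i = 0.
Proof.
move=> i_gt1 /andP[gtNi ltiq].
apply: (roots_geq_poly_eq0 (rs := enum (~: determined))) (enum_uniq _) _.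
  apply/allP => y; rewrite mem_enum inE => /redei_at_undetermined sly.
  rewrite /root -coef_redei_at sly coefB coefXn coefX.
  by rewrite (ltn_eqF ltiq) (gtn_eqF i_gt1) subrr.
rewrite -cardE cardsCs setCK (leq_trans (size_coef_redei (ltnW ltiq))) //.
by rewrite ltn_sub2l // (ltn_trans gtNi).
Qed.

Lemma size_redei_at_subXn y : y \in determined ->
  (size (redei_at y - 'X^q)%R <= #|determined|.+1)%N.
Proof.
move=> Dy; have N_gt0 : (0 < #|determined|)%N by apply/card_gt0P; exists y.
apply/leq_sizeP => j ltNj; rewrite coefB coefXn.
have [ltjq|gtjq|->] := ltngtP j q.
- by rewrite coef_redei_at redei_gap ?horner0 ?subr0 ?ltNj // (leq_trans _ ltNj).
- by rewrite nth_default ?subr0 // size_redei_at.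
- have := redei_at_monic y; rewrite monicE lead_coefE size_redei_at => /eqP ->.
  by rewrite subrr.
Qed.

(** Write the polynomial P as X^q + g.  As P divides (X^q - X) P', it divides
    (X + g) g', whose degree is too small; and g is not -X, because P has a
    multiple root. *)
Lemma redei_at_deriv0 y :
  (#|determined|.*2 <= q)%N -> y \in determined -> (redei_at y)^`() = 0.
Proof.
move=> leNq Dy; set N := #|determined| in leNq *.
have N_gt0 : (0 < N)%N by apply/card_gt0P; exists y.
set P := redei_at y; pose g := P - 'X^q.
have size_g : (size g <= N.+1)%N := size_redei_at_subXn Dy.
have dP : P^`() = g^`() by rewrite derivB deriv_XnCard subr0.
have dvdP : P %| (g + 'X) * P^`().
  have -> : (g + 'X) * P^`() = P * P^`() - ('X^q - 'X) * P^`().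
    by rewrite -mulrBl; congr (_ * _); rewrite opprB addrCA addrC.
  apply: dvdp_sub; first exact: dvdp_mulr.
  have := prod_XsubC_dvd_deriv [seq f x - x * y | x <- enum F].
  by rewrite /= big_map big_enum.
apply/eqP; have : (g + 'X) * P^`() == 0.
  apply: contraTT dvdP => nz; apply/negP => /(dvdp_leq nz).
  rewrite leqNgt size_redei_at ltnS (leq_trans (size_polyMleq _ _)) //.
  have size_gX : (size (g + 'X)%R <= N.+1)%N.
    by rewrite (leq_trans (size_polyD _ _)) // geq_max size_g size_polyX.
  have size_dg : (size P^`() <= N)%N.
    by rewrite dP (leq_trans (size_poly _ _)) // -ltnS; case: (size g) size_g.
  rewrite -subn1; apply: leq_trans (leq_sub2r 1 (leq_add size_gX size_dg)) _.
  by rewrite addSn subn1 addnn.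
rewrite mulf_eq0 => /orP[|//]; rewrite addr_eq0 => /eqP gX.
have PX : P = 'X^q - 'X by rewrite -gX addrC subrK.
have eq_roots : perm_eq [seq f x - x * y | x <- enum F] (enum F).
  apply: prod_XsubC_eq; rewrite big_map !big_enum -finField_genPoly.
  exact: PX.
by move: Dy; rewrite inE /injectiveb /dinjectiveb (perm_uniq eq_roots) enum_uniq.
Qed.

(** For odd i > 1 the coefficient of X^i vanishes at every slope, determined or
    not, and its degree is less than q; for even i it is killed by
    differentiation. *)
Lemma redei_deriv_const :
  (#|determined|.*2 <= q)%N -> redei^`() = (redei`_1)%:P.
Proof.
move=> leNq; apply/polyP => -[|i]; rewrite coef_deriv coefC ?mulr1n //=.
have [odd_i|even_i] := boolP (odd i.+2); last first.
  apply/eqP; rewrite -mulr_natr -polyC_natr.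
  by have /eqP-> : i.+2%:R == 0 :> F;
    rewrite ?mulr0 // -(dvdn_pcharf pchar2) dvdn2.
suff -> : redei`_i.+2 = 0 by rewrite mul0rn.
have [ltiq|leqi] := ltnP i.+2 q; last first.
  rewrite nth_default // size_redei ltn_neqAle leqi andbT.
  by apply: contraTneq odd_i => <-; rewrite cardF oddX orbF -lt0n h_gt0.
apply: (roots_geq_poly_eq0 (rs := enum F)) (enum_uniq _) _; last first.
  rewrite -cardE (leq_trans (size_coef_redei (ltnW ltiq))) //.
  by rewrite ltn_subrL /= (leq_trans _ ltiq).
apply/allP => y _; rewrite /root -coef_redei_at.
have [Dy|/redei_at_undetermined->] := boolP (y \in determined).
  have /polyP/(_ i.+1) := redei_at_deriv0 leNq Dy.
  rewrite coef_deriv coef0 -mulr_natr => /eqP; rewrite mulf_eq0 => /orP[//|].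
  by rewrite -(dvdn_pcharf pchar2) dvdn2 odd_i.
by rewrite coefB coefXn coefX (ltn_eqF ltiq) subrr.
Qed.

Lemma mup_prod (I : finType) (P : pred I) (p : I -> {poly F}) y :
  (forall i, P i -> p i != 0) ->
  mup y (\prod_(i | P i) p i) = (\sum_(i | P i) mup y (p i))%N.
Proof.
move=> nz_p; pose K (r : {poly F}) n := r != 0 /\ mup y r = n.
suff [] : K (\prod_(i | P i) p i) (\sum_(i | P i) mup y (p i))%N by [].
apply: big_ind2 => [|r1 n1 r2 n2 [nz1 <-] [nz2 <-]|i Pi].
- by split; rewrite ?oner_neq0 // mupNroot // root1.
- by split; rewrite ?mulf_neq0 ?mupM.
- by split; rewrite ?nz_p.
Qed.

Lemma mup_line (a b y : F) :
  b != 0 -> mup y (a%:P - b *: 'X) = (a == b * y).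
Proof.
move=> nz_b; have [ay|ne_ay] := eqVneq a (b * y); last first.
  by apply: mupNroot; rewrite /root !hornerE subr_eq0.
have -> : a%:P - b *: 'X = (- b)%:P * ('X - y%:P) ^+ 1.
  by rewrite expr1 ay -mul_polyC polyCM polyCN; ring.
by rewrite mupMr ?mup_XsubCX ?eqxx // rootC oppr_eq0.
Qed.

(** The value of the derivative at the root f x - x Y is the product of the
    f x - f x' - (x - x') Y over the other x'; its multiplicity at y counts the
    other points of the graph on the line of slope y through (x, f x).  As the
    derivative is constant in X, this number does not depend on x. *)
Lemma card_fibre x y : (#|determined|.*2 <= q)%N ->
  #|[set x' | f x' - x' * y == f x - x * y]| = (mup y (redei`_1)%R).+1.
Proof.
move=> leNq; pose l x' := (f x')%:P - x' *: 'X.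
have -> : redei`_1 = \prod_(x' | x' != x) (l x - l x').
  have <- : redei^`().[l x] = redei`_1 by rewrite redei_deriv_const // hornerC.
  rewrite /redei (bigD1 x) //= derivM derivXsubC mul1r hornerD hornerM.
  rewrite hornerXsubC subrr mul0r addr0 horner_prod.
  by apply: eq_bigr => x' _; rewrite hornerXsubC.
have mup_l x' : x' != x ->
    mup y (l x - l x') = (f x' - x' * y == f x - x * y) /\ l x - l x' != 0.
  move=> ne_x; have -> : l x - l x' = (f x - f x')%:P - (x - x') *: 'X.
    by rewrite polyCB scalerBl /l; ring.
  have nz_x : x - x' != 0 by rewrite subr_eq0 eq_sym.
  split; last first.
    apply: contraNneq nz_x => /polyP/(_ 1%N).
    by rewrite coefB coefC coefZ coefX mulr1 coef0 sub0r => /eqP; rewrite oppr_eq0.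
  rewrite mup_line // eq_sym -subr_eq0 -[in RHS]subr_eq0; congr (nat_of_bool (_ == 0)).
  ring.
rewrite mup_prod => [|x' /mup_l[] //].
rewrite (cardsD1 x) inE eqxx add1n; congr _.+1.
rewrite -sum1_card big_mkcond [RHS]big_mkcond; apply: eq_bigr => x' _.
rewrite !inE; have [//|/mup_l[-> _]] := eqVneq x' x.
by case: (_ == _).
Qed.

End Directions.

(** * Lacunary polynomials that split over a field of even order *)

Lemma pchar2_poly (F : fieldType) : 2 \in [pchar F] -> 2 \in [pchar {poly F}].
Proof.
by move=> ch2; rewrite inE /= -polyC_natr (pcharf0 ch2) eqxx.
Qed.

Lemma exprD_pow2 (R : comNzRingType) (x y : R) e : 2 \in [pchar R] ->
  (x + y) ^+ (2 ^ e) = x ^+ (2 ^ e) + y ^+ (2 ^ e).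
Proof.
by move=> ch2; rewrite exprDn_pchar // (eq_pnat _ (pcharf_eq ch2)) pnatX pnat_id.
Qed.

Lemma coef_exp_pow2_neq0 (F : fieldType) (e : nat) (p : {poly F}) i :
  2 \in [pchar F] -> (p ^+ (2 ^ e))`_i != 0 ->
  (2 ^ e %| i)%N /\ p`_(i %/ 2 ^ e) != 0.
Proof.
move=> ch2; have s_gt0 : (0 < 2 ^ e)%N by rewrite expn_gt0.
elim/poly_ind: p i => [|p c IH] i; first by rewrite expr0n eqn0Ngt s_gt0 /= coef0 eqxx.
rewrite (exprD_pow2 _ _ _ (pchar2_poly ch2)) exprMn -polyC_exp coefD coefMXn coefC.
have [->|nz_i] := eqVneq i 0%N.
  rewrite s_gt0 add0r expf_eq0 s_gt0 dvdn0 div0n coefD coefMX coefC !eqxx add0r.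
  by [].
rewrite addr0; case: ltnP => [|le_si]; first by rewrite eqxx.
case/IH => dvd_s nz_p; split; first by rewrite -(dvdn_subl le_si).
have -> : (i %/ 2 ^ e = ((i - 2 ^ e) %/ 2 ^ e).+1)%N.
  by rewrite -{1}(subnK le_si) divnDr // divnn s_gt0 addn1.
by rewrite coefD coefMX coefC /= addr0.
Qed.

Section Lacunary.
Variables (F : finFieldType) (h : nat).
Local Notation q := #|F|.
Hypothesis cardF : q = (2 ^ h)%N.

(** Let s = 2^e and P = X^m + g.  As P divides X^q - X and P^s = X^q + g^s, it
    divides X + g^s, with a quotient Q.  The derivative of X + g^s is 1, and
    the bound on the degree of g forces Q to be a constant c.  Comparing
    coefficients in c (X^m + g) = X + g^s, an exponent i of g other than 1 is a
    multiple of s, and i / s is again an exponent of g.  Descending from the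
    leading exponent m / s, a power of 2, one reaches 1: so m is a power of
    s. *)
Lemma lacunary_subfield e m N (P : {poly F}) :
  (0 < e < h)%N -> (m * 2 ^ e)%N = q -> P \is monic -> size P = m.+1 ->
  P %| 'X^q - 'X -> (size (P ^+ (2 ^ e) - 'X^q)%R <= N.+1)%N ->
  ((2 ^ e).+1 * N <= 2 * q)%N -> (e %| h)%N /\ (m <= N)%N.
Proof.
move=> /andP[e_gt0 lt_eh] def_q monP sizeP dvdP sizePs leN.
have ch2 := pchar2 cardF; set s := (2 ^ e)%N in def_q sizePs leN *.
have s_gt1 : (1 < s)%N by rewrite -{1}(expn0 2) ltn_exp2l.
have def_m : m = (2 ^ (h - e))%N.
  by apply/eqP; rewrite -(eqn_pmul2r (ltnW s_gt1)) def_q cardF -expnD subnK // ltnW.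
have even0 (r : {poly F}) j : (0 < j)%N -> r *+ 2 ^ j = 0.
  move=> j_gt0; rewrite -mulr_natr -polyC_natr.
  have /eqP -> : (2 ^ j)%:R == 0 :> F by rewrite -(dvdn_pcharf ch2) dvdn_exp.
  by rewrite mulr0.
pose g := P - 'X^m; pose B := 'X + g ^+ s.
have defP : P = 'X^m + g by rewrite addrC subrK.
have size_g : (size g <= m)%N.
  apply/leq_sizeP => j lemj; rewrite coefB coefXn.
  have [ltmj|gtmj|<-] := ltngtP m j; last 1 first.
  - by move: monP; rewrite monicE lead_coefE sizeP => /eqP ->; rewrite subrr.
  - by rewrite nth_default ?subr0 // sizeP.
  - by rewrite leqNgt gtmj in lemj.
have defPs : P ^+ s = 'X^q + g ^+ s.
  by rewrite defP (exprD_pow2 _ _ _ (pchar2_poly ch2)) -exprM def_q.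
(* B is the polynomial X + g^s that P divides. *)
have dvdPB : P %| B.
  have -> : B = P ^+ s - ('X^q - 'X) by rewrite defPs /B; ring.
  by rewrite dvdp_sub // dvdp_exp // ltnW.
have dB : B^`() = 1.
  by rewrite derivD derivX deriv_exp even0 // addr0.
have nzB : B != 0.
  by apply: contra_eq_neq dB => ->; rewrite deriv0 eq_sym oner_neq0.
have m_gt1 : (1 < m)%N by rewrite def_m -{1}(expn0 2) ltn_exp2l // subn_gt0.
set d := (size g).-1.
have size_gs : (size (g ^+ s)).-1 = (d * s)%N by exact: size_exp.
have size_gs_le : (d * s <= N)%N.
  by move: sizePs; rewrite -size_gs defPs addrC addKr; case: (size _).
have sizeB_ge : (m < size B)%N by rewrite -sizeP dvdp_leq.
have sizeB : size B = (d * s).+1.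
  have : (2 < size (g ^+ s))%N.
    rewrite ltnNge; apply: contraL sizeB_ge => le2.
    rewrite -leqNgt (leq_trans (size_polyD _ _)) // size_polyX geq_max.
    by rewrite m_gt1 (leq_trans le2).
  move=> gt2; rewrite /B addrC size_polyDl ?size_polyX //.
  by rewrite -size_gs prednK // (ltn_trans _ gt2).
have le_mN : (m <= N)%N by rewrite (leq_trans _ size_gs_le) // -ltnS -sizeB.
split=> //.
have [Q defB] := dvdpP _ _ dvdPB.
have nzP : P != 0 by rewrite monic_neq0.
have nzQ : Q != 0 by apply: contraNneq nzB => Q0; rewrite defB Q0 mul0r.
have sizeQ : size B = (size Q + m)%N.
  by rewrite defB size_Mmonic // sizeP addnS.
have dP : P^`() = g^`().
  by rewrite defP derivD derivXn {2}def_m even0 ?add0r // subn_gt0.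
have eq1 : 1 = Q^`() * P + Q * g^`() by rewrite -dB defB derivM dP.
have size_dg : (size g^`() <= d)%N by apply: leq_trans (size_poly _ _) _.
(* This is where the bound on N enters: it leaves no room for Q to be
   nonconstant in the derivative 1 = Q' P + Q g' of B = Q P. *)
have size_Qdg : (size (Q * g^`())%R <= m)%N.
  apply: leq_trans (size_polyMleq _ _) _; rewrite -subn1 leq_subLR.
  apply: leq_trans (leq_add (leqnn _) size_dg) _.
  have : ((2 ^ e).+1 * (d * s) <= 2 * (m * s))%N.
    by rewrite def_q (leq_trans _ leN) // leq_mul2l size_gs_le orbT.
  rewrite mulnA mulnA leq_pmul2r; last exact: ltnW.
  rewrite -/s => le_d; move: sizeB; rewrite sizeQ => szQ.
  have : (size Q + m + d <= 1 + m + m)%N.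
    by rewrite szQ addSn (mulnC d) -mulSnr; move: le_d; rewrite mul2n -addnn !add1n addSn.
  by rewrite addnAC leq_add2r.
have dQ : Q^`() = 0.
  apply/eqP; apply: contraT => nz_dQ.
  have : (size (Q^`() * P)%R <= m)%N.
    have -> : Q^`() * P = 1 - Q * g^`() by rewrite {1}eq1 addrK.
    rewrite (leq_trans (size_polyD _ _)) // size_polyN geq_max size_poly1.
    by rewrite size_Qdg ltnW.
  rewrite size_Mmonic // sizeP addnS /= leqNgt -{1}[m]add0n ltn_add2r.
  by rewrite lt0n size_poly_eq0 nz_dQ.
have [c nz_c defQ] : exists2 c, c != 0 & Q = c%:P.
  have : Q \is a GRing.unit.
    by apply/unitrPr; exists g^`(); rewrite [RHS]eq1 dQ mul0r add0r.
  by rewrite poly_unitE => /andP[/size_poly1P].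
have def_ds : (d * s)%N = m.
  by apply/eqP; rewrite -eqSS -sizeB sizeQ defQ size_polyC nz_c add1n.
have coef_g i : i != 1%N -> (i < m)%N -> g`_i != 0 ->
    (s %| i)%N /\ g`_(i %/ s) != 0.
  move=> ne_i1 lt_im nz_gi; apply: coef_exp_pow2_neq0 => //.
  have /polyP/(_ i) := defB; rewrite defQ coefD coefX (negPf ne_i1) add0r => ->.
  by rewrite coefCM defP coefD coefXn (ltn_eqF lt_im) add0r mulf_neq0.
(* The descent on exponents that are powers of 2. *)
have e_dvd j : g`_(2 ^ j)%N != 0 -> (2 ^ j < m)%N -> (e %| j)%N.
  elim/ltn_ind: j => -[//|j] IH nz_g lt_m.
  have [|dvd_s nz_g'] := coef_g _ _ lt_m nz_g.
    by rewrite -(expn0 2) eqn_exp2l.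
  have le_ej : (e <= j.+1)%N by rewrite dvdn_Pexp2l in dvd_s.
  rewrite -(dvdn_subl le_ej) //; apply: IH.
  - by rewrite ltn_subrL e_gt0.
  - by rewrite expnB.
  - by rewrite (leq_ltn_trans _ lt_m) // leq_exp2l // leq_subr.
have [le_e_he def_d] : (e <= h - e)%N /\ d = (2 ^ (h - e - e))%N.
  have dvd_s : (s %| 2 ^ (h - e))%N by rewrite -def_m -def_ds dvdn_mull.
  rewrite dvdn_Pexp2l // in dvd_s; split=> //.
  by rewrite expnB // -def_m -def_ds mulnK // ltnW.
rewrite -(dvdn_subl (ltnW lt_eh)) // -(dvdn_subl le_e_he) //.
have d_gt0 : (0 < d)%N by rewrite def_d expn_gt0.
apply: e_dvd; rewrite -def_d; last by rewrite -def_ds ltn_Pmulr.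
rewrite -lead_coefE lead_coef_eq0 -size_poly_eq0.
by move: d_gt0; rewrite /d; case: (size g).
Qed.

End Lacunary.

(** * Functions that determine few directions *)

Lemma largest_proper_divisor_subn h t :
  largest_proper_divisor h t -> (h - t < h)%N.
Proof.
case=> dvd_t lt_th _; have h_gt0 := leq_ltn_trans (leq0n t) lt_th.
by rewrite ltn_subrL h_gt0 (dvdn_gt0 h_gt0).
Qed.

Section FewDirections.
Variables (F : finFieldType) (f : F -> F) (h t : nat).
Local Notation q := #|F|.
Hypotheses (cardF : q = (2 ^ h)%N) (ht : largest_proper_divisor h t).
Local Notation D := (determined f).
Hypothesis leDT : (#|D| <= 2 ^ (h - t))%N.

Let h_gt0 : (0 < h)%N. Proof. by case: ht => _ /(leq_ltn_trans _) ->. Qed.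

Let le_2D : (#|D|.*2 <= q)%N.
Proof.
have lt_h := largest_proper_divisor_subn ht.
rewrite -mul2n; apply: (@leq_trans (2 * 2 ^ (h - t))).
  by rewrite leq_mul2l leDT.
by rewrite -expnS cardF leq_exp2l.
Qed.

(** The number of points of the graph on any line of slope y that meets it. *)
Definition secant_size (y : F) := (mup y (redei f)`_1)%R.+1.

Lemma card_fibreE x y : #|[set x' | f x' - x' * y == f x - x * y]| = secant_size y.
Proof. exact: card_fibre cardF _ _ _. Qed.

Definition intercepts y := [set f x - x * y | x in F].

Lemma card_intercepts y : (#|intercepts y| * secant_size y)%N = q.
Proof.
rewrite -[RHS]sum1_card (partition_big_imset (fun x => f x - x * y)) /=.
rewrite -sum_nat_const; apply: eq_bigr => v /imsetP[x _ ->].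
rewrite -(card_fibreE x) -sum1_card.
by apply: eq_bigl => x'; rewrite inE.
Qed.

Lemma redei_at_intercepts y :
  redei_at f y = (\prod_(v in intercepts y) ('X - v%:P)) ^+ secant_size y.
Proof.
rewrite /redei_at (partition_big_imset (fun x => f x - x * y)) /= -prodrXl.
apply: eq_bigr => v /imsetP[x _ ->]; rewrite -(card_fibreE x) -prodr_const.
apply: eq_big => x'; first by rewrite inE.
by move/eqP ->.
Qed.

Lemma secant_size_pow2 y : exists2 e, (e <= h)%N & secant_size y = (2 ^ e)%N.
Proof.
apply/(dvdn_pfactor _ _ (isT : prime 2)).
by rewrite -cardF -(card_intercepts y) dvdn_mull.
Qed.

Lemma secant_size_gt1 y : y \in D -> (1 < secant_size y)%N.
Proof.
rewrite inE => /injectivePn[x [x' ne_x eq_f]]; rewrite -(card_fibreE x).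
apply/card_gt1P; exists x, x'; split=> //; rewrite inE; first exact/eqP.
by rewrite eq_f.
Qed.

(** Every point of the graph other than (0, f 0) lies on exactly one secant
    through (0, f 0). *)
Lemma sum_secant_size : (\sum_(y in D) secant_size y)%N = (q.-1 + #|D|)%N.
Proof.
pose slope x := (f x - f 0) / x.
have slopeD x : x != 0 -> slope x \in D.
  move=> nz_x; rewrite inE; apply/injectivePn; exists x; exists 0 => //.
  by rewrite /slope mulrC divfK // mul0r subr0 opprB addrC subrK.
suff <- : (\sum_(y in D) (secant_size y).-1 = q.-1)%N.
  rewrite -sum1_card -big_split /=; apply: eq_bigr => y _.
  by rewrite addn1.
have -> : q.-1 = #|[pred x : F | x != 0]|.
  by rewrite -(cardC1 (0 : F)); apply: eq_card => x; rewrite !inE.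
rewrite -[RHS]sum1_card [RHS](partition_big slope (fun y => y \in D)) //.
apply: eq_bigr => y _.
rewrite -(card_fibreE 0) (cardsD1 0) inE eqxx /= -sum1_card.
apply: eq_bigl => x; rewrite !inE; have [//|nz_x] := eqVneq x 0.
rewrite /= mul0r subr0 /slope subr_eq addrC -subr_eq mulrC.
by rewrite -(can_eq (divfK nz_x)) mulrK ?unitfE // eq_sym.
Qed.

(** Unless some secant contains the whole graph, let s = 2^e be the least secant
    size.  The counting bound |D| (s - 1) <= q - 1 allows
    [lacunary_subfield] to be applied to the product of the distinct factors of
    the Redei polynomial: GF(s) is a subfield, so e <= t, and
    2^(h - e) <= |D| <= 2^(h - t), hence |D| = q / s, a multiple of s.  But s
    divides all secant sizes, and these add up to q - 1 + |D|. *)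
Theorem few_directions_affine : exists m, forall x, f x = f 0 + x * m.
Proof.
have [/existsP[y /eqP mult_y]|] := boolP [exists y, secant_size y == q].
  exists y => x; have : x \in [set x' | f x' - x' * y == f 0 - 0 * y].
    suff -> : [set x' | f x' - x' * y == f 0 - 0 * y] = setT by rewrite inE.
    by apply/eqP; rewrite eqEcard subsetT cardsT card_fibreE mult_y /=.
  by rewrite inE mul0r subr0 subr_eq => /eqP.
rewrite negb_exists => /forallP ne_q; exfalso.
have D1 : f 1 - f 0 \in D.
  rewrite inE; apply/injectivePn; exists 1; exists 0; first exact: oner_neq0.
  by rewrite mul1r mul0r subr0 opprB addrC subrK.
case: (arg_minnP secant_size D1) => y Dy min_y.
have [e le_eh def_s] := secant_size_pow2 y; set s := secant_size y in def_s min_y.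
have s_gt1 : (1 < s)%N := secant_size_gt1 Dy.
have e_gt0 : (0 < e)%N by move: s_gt1; rewrite def_s; case: (e).
have lt_eh : (e < h)%N.
  rewrite ltn_neqAle le_eh andbT; apply: contraNneq (ne_q y) => eh.
  by rewrite -/s def_s cardF eh.
have q_gt0 : (0 < q)%N by rewrite cardF expn_gt0.
have le_Ds : (#|D| * s <= q.-1 + #|D|)%N.
  by rewrite -sum_secant_size -sum_nat_const leq_sum.
have leN : ((2 ^ e).+1 * #|D| <= 2 * q)%N.
  rewrite -def_s; move: le_Ds le_2D q_gt0 s_gt1; rewrite -subn1 -muln2.
  case: s {def_s min_y} => [|[|[|s]]] //.
    move: #|D| #|F| => N Q; lia.
  move: #|D| #|F| => N Q; nia.
have [||||||dvd_eh le_mN] := lacunary_subfield cardF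
    (P := \prod_(v in intercepts y) ('X - v%:P)) (m := #|intercepts y|) _ _ _ _ _ _ leN.
- by rewrite e_gt0.
- by rewrite -def_s card_intercepts.
- exact: monic_prod_XsubC.
- by rewrite -big_enum size_prod_XsubC -cardE.
- rewrite finField_genPoly [X in _ %| X](bigID (mem (intercepts y))) /=.
  exact: dvdp_mulr.
- by rewrite -def_s -redei_at_intercepts; exact: size_redei_at_subXn Dy.
have def_m : #|intercepts y| = (2 ^ (h - e))%N.
  by rewrite expnB // -cardF -(card_intercepts y) -/s def_s mulnK // expn_gt0.
have le_et : (e <= t)%N by case: ht => _ _; apply.
have cardD : #|D| = (2 ^ (h - e))%N.
  apply/eqP; rewrite eqn_leq -def_m le_mN andbT def_m (leq_trans leDT) //.
  by rewrite leq_exp2l // leq_sub2l.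
have dvd_sD : (2 ^ e %| #|D|)%N.
  rewrite cardD dvdn_exp2l // dvdn_leq ?subn_gt0 //.
  by rewrite dvdn_subr // ltnW.
have dvd_sum : (2 ^ e %| \sum_(y' in D) secant_size y')%N.
  apply: dvdn_sum => y' Dy'; have [e' _ def_s'] := secant_size_pow2 y'.
  have := min_y y' Dy'; rewrite def_s def_s' leq_exp2l // => le_ee'.
  exact: dvdn_exp2l.
move: dvd_sum; rewrite sum_secant_size dvdn_addl // => dvd_q1.
have : (2 ^ e %| q - q.-1)%N by rewrite dvdn_sub // cardF dvdn_exp2l.
by rewrite -subn1 subKn // dvdn1 -def_s (gtn_eqF s_gt1).
Qed.

End FewDirections.

(** * Arcs of an affine plane of even order *)

Lemma size_prod_XsubC_set (F : fieldType) (I : finType) (B : {set I}) (y : I -> F) :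
  size (\prod_(c in B) ('X - (y c)%:P)) = #|B|.+1.
Proof. by rewrite -big_enum size_prod_XsubC -cardE. Qed.

(** Compare the coefficients of X^(#|B| - 1) in the Lagrange interpolation
    formula for w at the nodes y b. *)
Lemma lead_coef_lagrange (F : fieldType) (I : finType) (B : {set I}) (y : I -> F)
    (w : {poly F}) : {in B &, injective y} -> (size w <= #|B|)%N ->
  \sum_(b in B) w.[y b] / \prod_(c in B :\ b) (y b - y c) = w`_(#|B|.-1).
Proof.
move=> inj_y size_w; pose L b := \prod_(c in B :\ b) ('X - (y c)%:P).
have L_self b : (L b).[y b] = \prod_(c in B :\ b) (y b - y c).
  by rewrite horner_prod; apply: eq_bigr => c _; rewrite hornerXsubC.
have L_other b c : c \in B -> c != b -> (L b).[y c] = 0.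
  move=> Bc ne_cb; rewrite horner_prod (bigD1 c) ?inE ?ne_cb //=.
  by rewrite hornerXsubC subrr mul0r.
have size_L b : b \in B -> size (L b) = #|B|.
  by move=> Bb; rewrite size_prod_XsubC_set [RHS](cardsD1 b) Bb.
have nzL b : b \in B -> (L b).[y b] != 0.
  move=> Bb; rewrite L_self prodf_seq_neq0; apply/allP => c _; apply/implyP.
  rewrite !inE => /andP[ne_cb Bc]; rewrite subr_eq0.
  by apply: contraNneq ne_cb => /(inj_y _ _ Bb Bc) ->.
pose W := \sum_(b in B) (w.[y b] / (L b).[y b]) *: L b.
have -> : w = W.
  apply/eqP; rewrite -subr_eq0; apply/eqP.
  apply: (roots_geq_poly_eq0 (rs := [seq y b | b in B])).
  - apply/allP => _ /imageP[b Bb ->]; rewrite /root !hornerE horner_sum.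
    rewrite (bigD1 b) //= big1 ?addr0 => [|c /andP[Bc ne_cb]].
      by rewrite hornerZ divfK ?nzL ?subrr.
    by rewrite hornerZ (L_other c b) ?mulr0 1?eq_sym.
  - by rewrite map_inj_in_uniq ?enum_uniq // => b c; rewrite !mem_enum; apply: inj_y.
  rewrite size_image (leq_trans (size_polyD _ _)) // size_polyN geq_max size_w.
  apply: leq_trans (size_sum _ _ _) _; apply/bigmax_leqP => b Bb.
  by rewrite (leq_trans (size_scale_leq _ _)) // size_L.
rewrite coef_sum; apply: eq_bigr => b Bb; rewrite coefZ -(L_self b).
have /monicP : L b \is monic by apply: monic_prod_XsubC.
rewrite lead_coefE size_L // => ->; rewrite mulr1 /W horner_sum.
rewrite (bigD1 b) //= big1 ?addr0 => [|c /andP[Bc ne_cb]].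
  by rewrite hornerZ divfK ?nzL.
by rewrite hornerZ (L_other c b) ?mulr0 1?eq_sym.
Qed.

(** The derivative of X^q - X at y. *)
Lemma prod_sub_neq (F : finFieldType) (y : F) : \prod_(v | v != y) (y - v) = -1.
Proof.
have := congr1 (fun p => (p^`()).[y]) (finField_genPoly F).
rewrite (bigD1 y) //= derivM derivXsubC mul1r !hornerE subrr mul0r addr0.
rewrite horner_prod derivB derivX derivXn !hornerE.
rewrite -mulr_natr hornerM -[_%:R]polyC_natr natr_card0 hornerC mulr0 sub0r => ->.
by apply: eq_bigr => v _; rewrite hornerXsubC.
Qed.

Lemma prod_sub_compl (F : finFieldType) (I : finType) (A : {set I}) (y : I -> F) a :
  a \in A -> {in A &, injective y} ->
  \prod_(c in A :\ a) (y a - y c) * \prod_(g in ~: (y @: A)) (y a - g) = -1.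
Proof.
move=> Aa inj_y; rewrite -(prod_sub_neq (y a)) [RHS](bigID (mem (y @: A))) /=.
congr (_ * _); last first.
  apply: eq_bigl => v; rewrite !inE andb_idl //.
  by apply: contraNneq => ->; apply: imset_f.
rewrite -(big_imset (fun v => y a - v)) /=; last first.
  by move=> b c /setD1P[_ Ab] /setD1P[_ Ac]; apply: inj_y.
apply: eq_bigl => v; apply/imsetP/andP => [[c /setD1P[ne_ca Ac] ->]|].
  split; last exact: imset_f.
  by apply: contraNneq ne_ca => /(inj_y _ _ Ac Aa) ->.
case=> ne /imsetP[c Ac def_v]; exists c; rewrite // !inE Ac andbT.
by apply: contraNneq ne => <-; rewrite def_v.
Qed.

(** The terms at (a, b) and (b, a) cancel in characteristic 2. *)
Lemma sum_sym_off_diag0 (R : nzRingType) (T : finType) (E : {set T}) (g : T -> T -> R) :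
  2 \in [pchar R] ->
  {in E &, forall a b, a != b -> g a b = g b a} ->
  \sum_(a in E) \sum_(b in E :\ a) g a b = 0.
Proof.
move=> ch2; have [n] := ubnP #|E|; elim: n E => // n IH E lt_En g_sym.
have [->|/set0Pn[e Ee]] := eqVneq E set0; first by rewrite big_set0.
have sub : {subset E :\ e <= E} by move=> a /setD1P[].
rewrite (big_setD1 e) //=.
have -> : \sum_(a in E :\ e) \sum_(b in E :\ a) g a b =
    \sum_(a in E :\ e) g e a + \sum_(a in E :\ e) \sum_(b in E :\ e :\ a) g a b.
  rewrite -big_split; apply: eq_bigr => a /setD1P[ne_ae Ea] /=.
  by rewrite (big_setD1 e) ?inE 1?eq_sym ?ne_ae //= g_sym // setDDl setUC -setDDl.
rewrite IH.
- by rewrite addr0 addrr_pchar2.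
- by rewrite (cardsD1 e E) Ee in lt_En.
by move=> a b /sub Ea /sub Eb; apply: g_sym.
Qed.

(** The computation behind [no_arc_three_free_directions]: H is the value at b of
    the product of tangents at a, M = m (m - mu) for the slope m of ab, d is the
    difference of abscissas, p and p' are the factors that depend on a alone, o and
    o' the products of offsets, which are symmetric in a and b. *)
Lemma weight_identity (F : fieldType) (H M o o' p p' d : F) :
  H * M * (o * d / p) = -1 ->
  - (p * p') / (M * o * o' * d ^+ 2) = H / (o' * d / p').
Proof.
move=> eqH; have : H * M * (o * d / p) != 0 by rewrite eqH oppr_eq0 oner_eq0.
rewrite !mulf_eq0 !negb_or invr_eq0 => /andP[/andP[_ nzM] /andP[/andP[nz_o nz_d] nz_p]].
have -> : H = - (p / (M * o * d)).
  apply: (mulIf (mulf_neq0 nzM (mulf_neq0 (mulf_neq0 nz_o nz_d) (invr_neq0 nz_p)))).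
  by rewrite mulrA eqH; field; rewrite ?nzM ?nz_o ?nz_d ?nz_p.
by rewrite !invfM !invrK; ring.
Qed.

Section PlaneArc.
Variables (F : finFieldType) (T : finType) (V : {set T}) (x z : T -> F) (mu : F).
Let slope a b := (z a - z b) / (x a - x b).
Hypotheses (ch2 : 2 \in [pchar F])
  (inj_x : {in V &, injective x})
  (nz_mu : mu != 0)
  (slope0 : {in V &, forall a b, a != b -> slope a b != 0})
  (slope_mu : {in V &, forall a b, a != b -> slope a b != mu})
  (arcV : {in V & &, forall a b c, a != b -> a != c -> b != c -> slope a b != slope a c}).

(** The vertical offset between c and the line ab; unlike a difference of slopes
    at a, it is symmetric in a and b. *)
Let offset a b c := slope a b * (x a - x c) - (z a - z c).

Let slopeC a b : slope a b = slope b a.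
Proof. by rewrite /slope -(opprB (z b)) -(opprB (x b)) invrN mulrNN. Qed.

Let nz_x a b : a \in V -> b \in V -> a != b -> x a - x b != 0.
Proof. by move=> Va Vb; rewrite subr_eq0; apply: contraNneq => /(inj_x Va Vb) ->. Qed.

Let offsetC a b c : a \in V -> b \in V -> a != b -> offset a b c = offset b a c.
Proof.
move=> Va Vb /(nz_x Va Vb) nz; rewrite /offset -(slopeC a b).
have : slope a b * (x a - x b) = z a - z b by rewrite divfK.
move: (slope a b) => m def_m.
have -> : z a = z b + m * (x a - x b) by rewrite def_m; ring.
ring.
Qed.

Let slope_diff a b c : a \in V -> c \in V -> a != c ->
  slope a b - slope a c = offset a b c / (x a - x c).
Proof.
by move=> Va Vc /(nz_x Va Vc) nz; rewrite mulrBl mulfK.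
Qed.

Let prod_slope_diff (E : {set T}) a b : E \subset V -> a \in V -> b \in E -> a != b ->
  \prod_(c in E :\ a :\ b) (slope a b - slope a c) =
  (\prod_(c in E :\ a :\ b) offset a b c) * (x a - x b)
   / \prod_(c in E :\ a) (x a - x c).
Proof.
move=> /subsetP sEV Va Eb ne_ab.
have -> : \prod_(c in E :\ a :\ b) (slope a b - slope a c) =
    \prod_(c in E :\ a :\ b) (offset a b c / (x a - x c)).
  apply: eq_bigr => c; rewrite !inE => /and3P[_ ne_ca Ec].
  by rewrite slope_diff // 1?eq_sym // sEV.
rewrite prodf_div [X in _ = _ / X](bigD1 b) /=; last by rewrite !inE eq_sym ne_ab.
have -> : \prod_(c in E :\ a :\ b) (x a - x c) =
    \prod_(i in E :\ a | i != b) (x a - x i).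
  by apply: eq_bigl => c; rewrite !inE andbC.
have nz_ab := nz_x Va (sEV _ Eb) ne_ab.
by rewrite invfM mulrA mulfK.
Qed.

(** The points V, with distinct abscissas x, form an arc that misses the vertical
    direction and the slopes 0 and mu.  Suppose 2 |V| > q and choose a subset E of
    V of size r = q - |V| + 1.  For a in E let h_a be the product of the
    X - g over the slopes g other than 0 and mu that are not determined at a; it
    is monic of degree r - 2.  Lagrange interpolation of h_a at the r - 1 slopes
    from a to the rest of E gives a sum equal to 1.  The terms of this sum are,
    up to a factor depending on a only, symmetric in a and b: the value of
    h_a at the slope of ab is the inverse of a product of slope differences
    over V (the product of all nonzero elements being -1), and such
    differences are offsets divided by differences of abscissas.  Summing over
    a, the symmetric terms cancel.  What remains is the interpolation sum at the
    abscissas of E for the product G of the X - xi over the elements xi that are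
    not abscissas of V; as G is monic of degree r - 1, this sum is 1. *)
Lemma no_arc_three_free_directions : (#|V|.*2 <= #|F|)%N.
Proof.
rewrite leqNgt; apply/negP => lt_qV.
pose r := (#|F| - #|V|).+1.
have le_VF : (#|V| <= #|F|)%N.
  by rewrite -(card_in_imset inj_x) max_card.
have [E sEV cardE] : exists2 E : {set T}, E \subset V & #|E| = r.
  have le_rV : (r <= #|V|)%N by rewrite /r; lia.
  exists [set c in take r (enum V)].
    by apply/subsetP => c; rewrite inE => /mem_take; rewrite mem_enum.
  rewrite cardsE; have /card_uniqP -> : uniq (take r (enum V)).
    by rewrite take_uniq ?enum_uniq.
  by rewrite size_takel // -cardE.
have sE c : c \in E -> c \in V by apply: (subsetP sEV).
pose S a := [set slope a b | b in V :\ a].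
have inj_slope a : a \in V -> {in V :\ a &, injective (slope a)}.
  move=> Va b c /setD1P[ne_ba Vb] /setD1P[ne_ca Vc] eq_bc; apply/eqP.
  apply: contraTT isT => ne_bc.
  have : slope a b != slope a c by apply: arcV; rewrite // eq_sym.
  by rewrite eq_bc eqxx.
pose h a := \prod_(g in ~: S a :\ 0 :\ mu) ('X - g%:P).
pose G := \prod_(xi in ~: (x @: V)) ('X - xi%:P).
pose piE (E : {set T}) a := \prod_(c in E :\ a) (x a - x c).
pose off (E : {set T}) a b := \prod_(c in E :\ a :\ b) offset a b c.
pose sym a b :=
  (slope a b * (slope a b - mu) * off V a b * off E a b * (x a - x b) ^+ 2)^-1.
have notS a m : a \in V -> {in V, forall b, a != b -> slope a b != m} -> m \in ~: S a.
  move=> Va ne_m; rewrite inE; apply/imsetP => -[b /setD1P[ne_ba Vb] def_m].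
  by have := ne_m b Vb; rewrite eq_sym ne_ba def_m eqxx => /(_ isT).
have S0 a : a \in V -> 0 \in ~: S a by move=> Va; apply: notS => // b Vb; apply: slope0.
have Smu a : a \in V -> mu \in ~: S a :\ 0.
  by move=> Va; rewrite !inE nz_mu -in_setC; apply: notS => // b Vb; apply: slope_mu.
have size_h a : a \in V -> size (h a) = r.-1.
  move=> Va; rewrite size_prod_XsubC_set.
  have := cardsC (S a); rewrite card_in_imset; last exact: inj_slope.
  rewrite (cardsD1 0 (~: _)) S0 // (cardsD1 mu (_ :\ 0)) Smu //.
  rewrite /r (cardsD1 a V) Va !add1n => <-.
  by rewrite !addnS subSS -addnS addKn.
have eval_h a b : a \in V -> b \in V -> a != b ->
    (h a).[slope a b] * (slope a b * (slope a b - mu)) *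
    \prod_(c in V :\ a :\ b) (slope a b - slope a c) = -1.
  move=> Va Vb ne_ab; have Vab : b \in V :\ a by rewrite !inE eq_sym ne_ab.
  rewrite -(prod_sub_compl Vab (inj_slope a Va)) [RHS]mulrC; congr (_ * _).
  rewrite [RHS](big_setD1 0) ?S0 //= subr0 (big_setD1 mu) ?Smu //=.
  rewrite mulrA mulrC; congr (_ * _).
  by rewrite horner_prod; apply: eq_bigr => g _; rewrite hornerXsubC.
have sum1 a : a \in E -> \sum_(b in E :\ a) sym a b = - (piE V a * piE E a)^-1.
  move=> Ea; have Va := sE a Ea.
  have cardEa : #|E :\ a| = r.-1 by rewrite -cardE (cardsD1 a E) Ea.
  have inj_E : {in E :\ a &, injective (slope a)}.
    by move=> b c /setD1P[ne_ba Eb] /setD1P[ne_ca Ec]; apply: inj_slope;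
      rewrite // !inE ?ne_ba ?ne_ca sE.
  have := lead_coef_lagrange (w := h a) inj_E.
  rewrite size_h // cardEa => /(_ (leqnn _)).
  rewrite -[in RHS](size_h a Va) -lead_coefE.
  have /monicP -> : h a \is monic by apply: monic_prod_XsubC.
  move=> lag; have : - (piE V a * piE E a) * \sum_(b in E :\ a) sym a b = 1.
    rewrite -lag.
    rewrite mulr_sumr; apply: eq_bigr => b /setD1P[ne_ba Eb].
    have ne_ab : a != b by rewrite eq_sym.
    have := eval_h a b Va (sE b Eb) ne_ab.
    have Vb := sE b Eb; rewrite !prod_slope_diff // /sym.
    rewrite -/(piE V a) -/(piE E a) -/(off V a b) -/(off E a b).
    exact: weight_identity.
  move: (piE V a * piE E a) => p eq_sum.
  have nz_p : p != 0.
    by apply: contra_eq_neq eq_sum => ->; rewrite oppr0 mul0r eq_sym oner_eq0.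
  by apply: (mulfI nz_p); apply: oppr_inj; rewrite -mulNr eq_sum mulrN divff ?opprK.
have : \sum_(a in E) \sum_(b in E :\ a) sym a b = 0.
  apply: sum_sym_off_diag0 => // a b Ea Eb ne_ab; congr (_^-1).
  have offC (E' : {set T}) : E' \subset V -> off E' a b = off E' b a.
    move=> sE'V; rewrite /off setDDl setUC -setDDl; apply: eq_bigr => c _.
    by rewrite offsetC ?sE.
  by rewrite !offC // slopeC -(opprB (x b)) sqrrN.
rewrite (eq_bigr _ sum1).
have evalG a : a \in E -> - (piE V a * piE E a)^-1 = G.[x a] / piE E a.
  move=> Ea; have := prod_sub_compl (sE a Ea) inj_x; rewrite -/(piE V a).
  have <- : G.[x a] = \prod_(g in ~: x @: V) (x a - g).
    by rewrite horner_prod; apply: eq_bigr => g _; rewrite hornerXsubC.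
  move=> eqG; have nz : piE V a != 0.
    by apply: contra_eq_neq eqG => ->; rewrite mul0r eq_sym oppr_eq0 oner_eq0.
  by rewrite invfM -mulNr; congr (_ * _); apply: (mulfI nz); rewrite eqG mulrN divff.
rewrite (eq_bigr _ evalG) lead_coef_lagrange; last 2 first.
- by move=> b c /sE Vb /sE Vc; apply: inj_x.
- by rewrite size_prod_XsubC_set cardE cardsCs setCK card_in_imset.
rewrite cardE; have : size G = r by rewrite size_prod_XsubC_set cardsCs setCK card_in_imset.
have /monicP : G \is monic by apply: monic_prod_XsubC.
by rewrite lead_coefE => /[swap] -> -> /eqP; rewrite oner_eq0.
Qed.

End PlaneArc.

(** * Arcs in coordinate space *)

Definition dot (F : finFieldType) (K : nat) (w : 'rV[F]_K) (u : 'cV[F]_K) : F :=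
  (w *m u) ord0 ord0.

Section Dot.
Variables (F : finFieldType) (K : nat).
Implicit Types (w : 'rV[F]_K) (u : 'cV[F]_K).

Lemma dot0l u : dot 0 u = 0. Proof. by rewrite /dot mul0mx mxE. Qed.
Lemma dotDl w w' u : dot (w + w') u = dot w u + dot w' u.
Proof. by rewrite /dot mulmxDl mxE. Qed.
Lemma dotBl w w' u : dot (w - w') u = dot w u - dot w' u.
Proof. by rewrite /dot mulmxBl !mxE. Qed.
Lemma dotZl a w u : dot (a *: w) u = a * dot w u.
Proof. by rewrite /dot -scalemxAl mxE. Qed.
Lemma dotZr a w u : dot w (a *: u) = a * dot w u.
Proof. by rewrite /dot -scalemxAr mxE. Qed.
Lemma dotBr w u u' : dot w (u - u') = dot w u - dot w u'.
Proof. by rewrite /dot mulmxBr !mxE. Qed.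
Lemma dot_sumr (I : finType) (P : pred I) (f : I -> 'cV[F]_K) w :
  dot w (\sum_(i | P i) f i) = \sum_(i | P i) dot w (f i).
Proof. by rewrite /dot mulmx_sumr summxE. Qed.
Lemma dot_suml (I : finType) (P : pred I) (f : I -> 'rV[F]_K) u :
  dot (\sum_(i | P i) f i) u = \sum_(i | P i) dot (f i) u.
Proof. by rewrite /dot mulmx_suml summxE. Qed.

Lemma dot_ext u u' : (forall w, dot w u = dot w u') -> u = u'.
Proof.
move=> eq_dot; apply/colP => i.
by have := eq_dot (delta_mx 0 i); rewrite /dot -!rowE !mxE.
Qed.

(** Evaluation at the points p i is injective, and its target is no larger than
    its source. *)
Lemma interpolation (I : finType) (p : I -> 'cV[F]_K) (g : I -> F) :
  (#|I| <= K)%N -> (forall w, (forall i, dot w (p i) = 0) -> w = 0) ->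
  exists w, forall i, dot w (p i) = g i.
Proof.
move=> leIK ker0; pose ev w := [ffun i => dot w (p i)].
have inj_ev : injective ev.
  move=> w w' /ffunP eq_ev; apply/eqP; rewrite -subr_eq0; apply/eqP/ker0 => i.
  by have := eq_ev i; rewrite !ffunE dotBl => ->; rewrite subrr.
have [|inv _ evK] := inj_card_bij inj_ev.
  rewrite card_ffun card_mx mul1n leq_exp2l //.
  exact: card_finNzRing_gt1.
by exists (inv (finfun g)) => i; have /ffunP/(_ i) := evK (finfun g); rewrite !ffunE.
Qed.

End Dot.

Section Arc.
Variables (F : finFieldType) (K : nat) (T : finType) (pt : T -> 'cV[F]_K).
Implicit Types (J S : {set T}) (w : 'rV[F]_K) (u v : 'cV[F]_K).

Definition zeros J w := [set j in J | dot w (pt j) == 0].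

(** Any K of the vectors pt j, with j in J, are linearly independent: no nonzero
    functional w vanishes on K of them. *)
Definition arc J := forall w, w != 0 -> (#|zeros J w| < K)%N.

(** The family pt on J together with the vector u is an arc. *)
Definition extends J u :=
  forall w, w != 0 -> (#|zeros J w| + (dot w u == 0%R) < K)%N.

Lemma extends_arc J u : extends J u -> arc J.
Proof. by move=> ext_u w /ext_u; apply: leq_ltn_trans; rewrite leq_addr. Qed.

Lemma extends_zero J u w (A : {set T}) : extends J u -> A \subset J ->
  {in A, forall j, dot w (pt j) = 0} -> dot w u = 0 -> (K <= #|A|.+1)%N -> w = 0.
Proof.
move=> ext_u /subsetP sAJ wA wu leK; apply/eqP; apply: contraLR leK => /ext_u.
rewrite wu eqxx addn1 -ltnNge; apply: leq_trans; rewrite ltnS; apply: subset_leq_card.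
by apply/subsetP => j Aj; rewrite inE sAJ // wA ?eqxx.
Qed.

Lemma arc_zero J w (A : {set T}) : arc J -> A \subset J ->
  {in A, forall j, dot w (pt j) = 0} -> (K <= #|A|)%N -> w = 0.
Proof.
move=> arcJ /subsetP sAJ wA leK; apply/eqP; apply: contraLR leK => /arcJ.
rewrite -ltnNge; apply: leq_ltn_trans; apply: subset_leq_card.
by apply/subsetP => j Aj; rewrite inE sAJ // wA ?eqxx.
Qed.

(** If some w vanishes on u, on v and on a set S of K - 2 points, then u, v and S
    are dependent.  As u and v are not proportional, some Q in S occurs in the
    dependency; projecting from the other points of S to a plane, with the line
    through u, v and Q at infinity, sends J minus S to an affine arc that misses
    the directions Q (vertical), u (slope 0) and v (slope mu). *)
Lemma extends_pair J u v : 2 \in [pchar F] ->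
  (#|F| + K.*2 < #|J|.*2 + 4)%N -> extends J u -> extends J v ->
  (forall a, v != a *: u) ->
  forall w, w != 0 -> (#|zeros J w| + (dot w u == 0%R) + (dot w v == 0%R) < K)%N.
Proof.
move=> ch2 ltJ ext_u ext_v not_prop w nz_w.
have arcJ := extends_arc ext_u.
have := ext_u w nz_w; have := ext_v w nz_w.
have [wu|_] := eqVneq (dot w u) 0; last by rewrite addn0.
have [wv|_] := eqVneq (dot w v) 0; last by rewrite !addn0.
rewrite !addn1 => ltSK _; rewrite ltn_neqAle ltSK andbT; apply/eqP => defK.
set S := zeros J w in ltSK defK.
have sSJ : S \subset J by apply/subsetP => j; rewrite inE => /andP[].
have wS j : j \in S -> dot w (pt j) = 0 by rewrite inE => /andP[_ /eqP].
have wV j : j \in J :\: S -> dot w (pt j) != 0.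
  by rewrite !inE => /andP[+ Jj]; rewrite Jj.
have cardJ : (#|S| + #|J :\: S|)%N = #|J|.
  by rewrite -[RHS](cardsID S J) (setIidPr sSJ).
have [j0 Vj0] : exists j0, j0 \in J :\: S.
  by apply/card_gt0P; lia.
have /setDP[Jj0 notSj0] := Vj0.
(* S, j0 and u are K independent vectors, so values on them can be prescribed. *)
have interp (g : option T -> F) : exists y,
    [/\ {in S, forall j, dot y (pt j) = g (Some j)}, dot y (pt j0) = 0 & dot y u = g None].
  pose B := j0 |: S.
  have sBJ : B \subset J by rewrite subUset sub1set Jj0.
  have cardB : #|B| = #|S|.+1 by rewrite cardsU1 notSj0.
  pose p (o : option {j | j \in B}) := if o is Some j then pt (val j) else u.
  pose g' (o : option {j | j \in B}) :=
    if o is Some j then if val j == j0 then 0 else g (Some (val j)) else g None.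
  have [||y def_y] := @interpolation F K _ p g'.
  - by rewrite card_option card_sig cardB defK.
  - move=> y y0; apply: (extends_zero ext_u sBJ); last by rewrite cardB defK.
      by move=> j Bj; apply: (y0 (Some (exist _ j Bj))).
    exact: (y0 None).
  exists y; split; last exact: (def_y None).
    move=> j Sj; have Bj : j \in B by rewrite inE Sj orbT.
    have := def_y (Some (exist _ j Bj)); rewrite /= => ->.
    by case: eqP => //= def_j; case/negP: notSj0; rewrite -def_j.
  have Bj : j0 \in B by rewrite !inE eqxx.
  by have := def_y (Some (exist _ j0 Bj)); rewrite /= eqxx.
have [y1 [y1S y1j0 y1u]] := interp (fun o => if o is None then 1 else 0).
have y1v : dot y1 v != 0.
  apply/eqP => y1v; have : dot y1 u = 0; last by apply/eqP; rewrite y1u oner_eq0.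
  rewrite (_ : y1 = 0) ?dot0l //; apply: (extends_zero ext_v (A := j0 |: S)) => //.
  - by rewrite subUset sub1set Jj0.
  - by move=> j /setU1P[->|/y1S].
  - by rewrite cardsU1 notSj0 defK.
have /fin_all_exists[yQ yQP] := fun Q => interp (fun o => (o == Some Q)%:R).
have yQS Q j : j \in S -> dot (yQ Q) (pt j) = (j == Q)%:R.
  by case: (yQP Q) => yS _ _ Sj; rewrite yS // (inj_eq Some_inj).
have yQj0 Q : dot (yQ Q) (pt j0) = 0 by case: (yQP Q).
have yQu Q : dot (yQ Q) u = 0 by case: (yQP Q).
(* If v vanishes on all the yQ, then v is a multiple of u. *)
have [/exists_inP[Q SQ nz_b]|] := boolP [exists Q in S, dot (yQ Q) v != 0]; last first.
  rewrite negb_exists_in => /forall_inP all0; have [] := negP (not_prop (dot y1 v)).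
  apply/eqP/dot_ext => y; rewrite dotZr.
  pose y' := y - dot y u *: y1 - \sum_(Q in S) dot y (pt Q) *: yQ Q
               - (dot y (pt j0) / dot w (pt j0)) *: w.
  have y'0 : y' = 0.
    apply: (extends_zero ext_u (A := j0 |: S)).
    - by rewrite subUset sub1set Jj0.
    - move=> j /setU1P[->|Sj]; rewrite !dotBl !dotZl dot_suml.
        rewrite y1j0 mulr0 subr0 divfK ?wV // big1 ?subr0 ?subrr // => Q SQ.
        by rewrite dotZl yQj0 mulr0.
      rewrite (wS j Sj) y1S // !mulr0 !subr0 (bigD1 j) //= big1 => [|Q /andP[SQ ne_Q]].
        by rewrite dotZl yQS // eqxx mulr1 addr0 subrr.
      by rewrite dotZl yQS // eq_sym (negPf ne_Q) mulr0.
    - rewrite !dotBl !dotZl dot_suml y1u wu mulr1 mulr0 subrr sub0r subr0 big1 ?oppr0 //.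
      by move=> Q SQ; rewrite dotZl yQu mulr0.
    by rewrite cardsU1 notSj0 defK.
  have : dot y' v = 0 by rewrite y'0 dot0l.
  rewrite !dotBl !dotZl dot_suml wv mulr0 subr0 big1 ?subr0 => [|Q SQ].
    by move/eqP; rewrite subr_eq0 mulrC => /eqP.
  by rewrite dotZl; have /negPn/eqP -> := all0 Q SQ; rewrite mulr0.
move: (yQ Q) nz_b (yQS Q) (yQu Q) => y2 nz_b y2S y2u.
(* Affine coordinates of the projection; w defines the line at infinity. *)
pose x j := dot y1 (pt j) / dot w (pt j).
pose z j := dot y2 (pt j) / dot w (pt j).
pose V := J :\: S.
have cardQ : #|S| = #|S :\ Q|.+1 by rewrite (cardsD1 Q) SQ.
have sVJ j : j \in V -> j \in J by case/setDP.
have notVS j : j \in V -> j \notin S by case/setDP.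
(* The line of slope m and intercept c, as a functional on the points. *)
pose line m c := y2 - m *: y1 - c *: w.
have lineQ m c : line m c != 0.
  apply/eqP => line0; have : dot (line m c) (pt Q) = 0 by rewrite line0 dot0l.
  rewrite !dotBl !dotZl y1S // wS // y2S // eqxx !mulr0 !subr0.
  by apply/eqP; rewrite oner_eq0.
have line0 m a b : a \in V -> b \in V -> z a - m * x a = z b - m * x b ->
    dot (line m (z a - m * x a)) (pt b) = 0.
  move=> Va Vb ->; rewrite !dotBl !dotZl /z /x; field; exact: wV.
have lineS m c j : j \in S :\ Q -> dot (line m c) (pt j) = 0.
  move=> /setD1P[ne_j Sj]; rewrite !dotBl !dotZl y1S // wS // y2S //.
  by rewrite (negPf ne_j) !mulr0 !subr0.
have lineu m c : dot (line m c) u = - m.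
  by rewrite !dotBl !dotZl y1u y2u wu mulr0 mulr1 sub0r subr0.
have linev m c : dot (line m c) v = dot y2 v - m * dot y1 v.
  by rewrite !dotBl !dotZl wv mulr0 subr0.
have inj_x : {in V &, injective x}.
  move=> a b Va Vb eq_x; apply/eqP; apply: contraT => ne_ab.
  have : dot (y1 - x a *: w) u != 0 by rewrite dotBl dotZl y1u wu mulr0 subr0 oner_neq0.
  suff -> : y1 - x a *: w = 0 by rewrite dot0l eqxx.
  have ker j : j \in V -> x a = x j -> dot (y1 - x a *: w) (pt j) = 0.
    by move=> Vj ->; rewrite dotBl dotZl divfK ?wV ?subrr.
  apply: (arc_zero (A := a |: (b |: S)) arcJ).
  - by rewrite !subUset !sub1set sVJ ?sVJ.
  - move=> j /setU1P[->|/setU1P[->|Sj]]; [exact: ker|exact: ker|].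
    by rewrite dotBl dotZl y1S // wS // mulr0 subrr.
  - by rewrite !cardsU1 in_setU1 negb_or ne_ab !notVS // -defK.
have slope_eq a b m : a \in V -> b \in V -> a != b ->
    (z a - z b) / (x a - x b) = m -> z a - m * x a = z b - m * x b.
  move=> Va Vb ne_ab <-.
  have nz : x a - x b != 0.
    by rewrite subr_eq0; apply: contraNneq ne_ab => /(inj_x _ _ Va Vb) ->.
  by field.
have ext_slope v' m : extends J v' -> (forall c, dot (line m c) v' = 0) ->
    {in V &, forall a b, a != b -> (z a - z b) / (x a - x b) != m}.
  move=> ext_v' linev' a b Va Vb ne_ab; apply/eqP => /(slope_eq _ _ _ Va Vb ne_ab) eq_ab.
  have /negP[] := lineQ m (z a - m * x a); apply/eqP.
  apply: (extends_zero (A := a |: (b |: (S :\ Q))) ext_v' _ _ (linev' _)).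
  - by rewrite !subUset !sub1set !sVJ // subDset subsetU ?sSJ ?orbT.
  - by move=> j /setU1P[->|/setU1P[->|Sj]]; [apply: line0|apply: line0|apply: lineS].
  - by rewrite !cardsU1 !in_setU1 !in_setD1 !negb_or ne_ab
      !(negPf (notVS _ _)) ?andbF // -defK cardQ.
suff : (#|V|.*2 <= #|F|)%N by rewrite /V; lia.
apply: (no_arc_three_free_directions (mu := dot y2 v / dot y1 v) ch2 inj_x).
- by rewrite mulf_neq0 ?invr_neq0.
- by apply: (ext_slope u) => // c; rewrite lineu oppr0.
- by apply: (ext_slope v) => // c; rewrite linev divfK ?subrr.
- move=> a b c Va Vb Vc ne_ab ne_ac ne_bc; apply/eqP => eq_ab.
  have eq_abz := slope_eq _ _ _ Va Vb ne_ab eq_ab.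
  have eq_acz := slope_eq _ _ _ Va Vc ne_ac erefl.
  set m := (z a - z c) / _ in eq_ab eq_abz eq_acz.
  have /negP[] := lineQ m (z a - m * x a); apply/eqP.
  apply: (arc_zero (A := a |: (b |: (c |: (S :\ Q)))) arcJ).
  - by rewrite !subUset !sub1set !sVJ // subDset subsetU ?sSJ ?orbT.
  - by move=> j /setU1P[->|/setU1P[->|/setU1P[->|Sj]]];
      [apply: line0|apply: line0|apply: line0|apply: lineS].
  - rewrite !cardsU1 !in_setU1 !in_setD1 !negb_or ne_ab ne_ac ne_bc
      !(negPf (notVS _ _)) ?andbF //.
    by rewrite -defK cardQ.
Qed.

End Arc.

(** * An additional coordinate is a permuted linear functional *)

Section ParallelLevels.
Variables (F : finFieldType) (h t : nat).
Hypotheses (cardF : #|F| = (2 ^ h)%N) (ht : largest_proper_divisor h t).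

(** M is a set of slopes of lines on which psi is injective.  Each level set of
    psi is the graph of a function whose directions avoid M, hence a line;
    disjoint lines of a plane are parallel. *)
Lemma parallel_levels (psi : F -> F -> F) (M : {set F}) :
  (forall s, injective (psi s)) -> 0 \in M ->
  (forall m s s' r r', m \in M -> s != s' -> psi s r = psi s' r' ->
     r - r' != m * (s - s')) ->
  (#|F| - 2 ^ (h - t) <= #|M|)%N ->
  exists2 m, m != 0 & forall s r, psi s (r + m * s) = psi 0 r.
Proof.
move=> inj_psi M0 transM leM.
pose f c s := invF (inj_psi s) c.
have psi_f c s : psi s (f c s) = c by rewrite f_invF.
have f_psi s r : f (psi s r) s = r by apply: (inj_psi s); rewrite psi_f.
have detM c y : y \in determined (f c) -> y \notin M.
  rewrite inE => /injectivePn[s [s' ne_s eq_f]]; apply/negP => My.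
  have := transM y s s' (f c s) (f c s') My ne_s; rewrite !psi_f => /(_ erefl) /eqP[].
  by rewrite -[f c s](subrK (s * y)) eq_f; ring.
have affine c : exists m, forall s, f c s = f c 0 + s * m.
  apply: (few_directions_affine cardF ht).
  have sub : determined (f c) \subset ~: M.
    by apply/subsetP => y /detM; rewrite inE.
  rewrite (leq_trans (subset_leq_card sub)) // cardsCs setCK.
  by rewrite leq_subLR addnC -leq_subLR.
have /fin_all_exists[m def_f] := affine.
have eq_m c c' : m c = m c'.
  apply/eqP; apply: contraT => ne_m.
  have nz : m c - m c' != 0 by rewrite subr_eq0.
  pose s := (f c' 0 - f c 0) / (m c - m c').
  have eq_fs : f c s = f c' s.
    by rewrite (def_f c s) (def_f c' s) /s; field.
  have eq_c : c = c' by rewrite -(psi_f c s) eq_fs psi_f.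
  by rewrite eq_c eqxx in ne_m.
exists (m 0).
  apply: contraTneq M0 => m0; apply: (@detM 0).
  rewrite inE; apply/injectivePn; exists 1; exists 0; first exact: oner_neq0.
  by rewrite (def_f 0 1) m0 !mulr0 addr0.
move=> s r; have <- : f (psi 0 r) s = r + m 0 * s.
  by rewrite def_f f_psi (eq_m _ 0) mulrC.
by rewrite psi_f.
Qed.

Section ExtraColumn.
Variables (K : nat) (T : finType) (pt : T -> 'cV[F]_K) (phi : 'rV[F]_K -> F).
Hypotheses (K_gt1 : (1 < K)%N) (leKT : (K <= #|T|)%N)
  (leT : (#|F| - 2 ^ (h - t) + K <= #|T|.+1)%N)
  (phiP : forall w w', w != w' ->
     (#|[set j | dot w (pt j) == dot w' (pt j)]| + (phi w == phi w')%R < K)%N).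

Let phi_inj w w' (A : {set T}) : {in A, forall j, dot w (pt j) = dot w' (pt j)} ->
  phi w = phi w' -> (K <= #|A|.+1)%N -> w = w'.
Proof.
move=> eqA eq_phi leKA; apply/eqP; apply: contraLR leKA => /phiP.
rewrite eq_phi eqxx addn1 -ltnNge; apply: leq_ltn_trans; rewrite ltnS.
by apply/subset_leq_card/subsetP => j Aj; rewrite inE eqA.
Qed.

Let ker_trivial w (A : {set T}) : {in A, forall j, dot w (pt j) = 0} ->
  (K <= #|A|)%N -> w = 0.
Proof.
apply: (arc_zero (J := setT)); rewrite ?subsetT // => {}w nz_w.
apply: leq_ltn_trans (phiP nz_w); rewrite (leq_trans _ (leq_addr _ _)) //.
by apply/subset_leq_card/subsetP => j; rewrite !inE dot0l.
Qed.

(** Let e_b be the basis dual to K of the points.  On each plane spanned by e_i and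
    e_0, [parallel_levels] gives a nonzero slope m_i(w) such that phi is
    invariant under e_i + m_i(w) e_0.  Composing two such moves in either order
    and using that phi is injective along e_0 shows that m_i(w + s e_j) is an
    affine function of s; having no zero, it is constant.  So phi is invariant
    under the vectors e_i + m_i e_0 with constants m_i, and depends only on the
    linear form that vanishes on all of them. *)
Theorem extra_column_linear :
  exists u, exists p : {perm F}, forall w, phi w = p (dot w u).
Proof.
have [B cardB] : exists B : {set T}, #|B| = K.
  exists [set j in take K (enum T)]; rewrite cardsE.
  have /card_uniqP -> : uniq (take K (enum T)) by rewrite take_uniq ?enum_uniq.
  by rewrite size_takel // -cardT.
have [e eP] : exists e : T -> 'rV[F]_K,
    {in B &, forall b j, dot (e b) (pt j) = (j == b)%:R}.
  have interp b := @interpolation F K {j | j \in B} (fun j => pt (val j))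
    (fun j => (val j == b)%:R).
  have /fin_all_exists[e eP] b : exists w, forall j : {j | j \in B},
      dot w (pt (val j)) = (val j == b)%:R.
    apply: interp; first by rewrite card_sig cardB.
    move=> w w0; apply: (@ker_trivial _ B); last by rewrite cardB.
    by move=> j Bj; apply: (w0 (exist _ j Bj)).
  by exists e => b j _ Bj; apply: (eP b (exist _ j Bj)).
have [i0 Bi0] : exists i0, i0 \in B by apply/card_gt0P; rewrite cardB ltnW.
pose B0 := B :\ i0; pose e0 := e i0.
have cardB0 : #|B0| = K.-1 by rewrite -cardB (cardsD1 i0 B) Bi0.
have sB0 b : b \in B0 -> b \in B by case/setD1P.
have e0B j : j \in B0 -> dot e0 (pt j) = 0.
  by case/setD1P => ne_j Bj; rewrite eP // (negPf ne_j).
have e0i0 : dot e0 (pt i0) = 1 by rewrite eP // eqxx.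
have inj_e0 w r r' : phi (w + r *: e0) = phi (w + r' *: e0) -> r = r'.
  move=> eq_phi; have : w + r *: e0 = w + r' *: e0.
    apply: (phi_inj (A := B0)) => // [j Bj|]; last by rewrite cardB0 leqSpred.
    by rewrite !dotDl !dotZl e0B // !mulr0.
  by move/(congr1 (fun w => dot w (pt i0))); rewrite !dotDl !dotZl e0i0 !mulr1 => /addrI.
have e_decomp w : w = \sum_(b in B) dot w (pt b) *: e b.
  apply/eqP; rewrite -subr_eq0; apply/eqP.
  apply: (@ker_trivial _ B); last by rewrite cardB.
  move=> j Bj; rewrite dotBl dot_suml (bigD1 j) //= big1 ?addr0 => [|b /andP[Bb ne_bj]].
    by rewrite dotZl eP // eqxx mulr1 subrr.
  by rewrite dotZl eP // eq_sym (negPf ne_bj) mulr0.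
have plane (iw : T * 'rV[F]_K) : exists m, iw.1 \in B0 -> m != 0 /\
    forall s r, phi (iw.2 + s *: e iw.1 + (r + m * s) *: e0) = phi (iw.2 + r *: e0).
  case: iw => i w /=; have [B0i|] := boolP (i \in B0); last by exists 0.
  have /setD1P[ne_i Bi] := B0i.
  have cardBi : #|B0 :\ i|.+2 = K.
    by rewrite -cardB (cardsD1 i0 B) Bi0 (cardsD1 i B0) B0i.
  pose a j := dot (e i) (pt j); pose b j := dot e0 (pt j).
  (* The coordinates that are not constant in the plane, apart from i: each
     contributes the slope of the lines on which it is constant, and i itself
     contributes the vertical direction. *)
  pose J := i0 |: ~: B.
  have nz_b j : j \in J -> b j != 0.
    case/setU1P => [->|]; first by rewrite /b e0i0 oner_neq0.
    rewrite inE => notBj; apply/eqP => bj0.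
    have : e0 = 0.
      apply: (@ker_trivial _ (j |: B0)); first by move=> l /setU1P[->|/e0B].
      rewrite cardsU1 cardB0 (_ : j \notin B0) ?add1n ?leqSpred //.
      by apply: contra notBj; apply: sB0.
    by move/(congr1 (fun w => dot w (pt i0))); rewrite e0i0 dot0l => /eqP; rewrite oner_eq0.
  have aBi j : j \in B0 :\ i -> a j = 0.
    by case/setD1P => ne_j /sB0 Bj; rewrite /a eP // (negPf ne_j).
  have notBiJ j : j \in J -> j \notin B0 :\ i.
    move=> Jj; rewrite in_setD1 in_setD1 !negb_and !negbK.
    by case/setU1P: Jj => [->|]; rewrite ?eqxx ?orbT // inE => ->; rewrite !orbT.
  have inj_m : {in J &, injective (fun j => - (a j / b j))}.
    move=> j l Jj Jl /oppr_inj eq_m; apply/eqP; apply: contraT => ne_jl.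
    have : e i - (a j / b j) *: e0 = 0.
      apply: (@ker_trivial _ (j |: (l |: (B0 :\ i)))).
        move=> x /setU1P[->|/setU1P[->|Bx]]; rewrite dotBl dotZl -/(a _) -/(b _).
        - by rewrite divfK ?nz_b ?subrr.
        - by rewrite eq_m divfK ?nz_b ?subrr.
        - by rewrite aBi // /b (e0B x) ?mulr0 ?subrr //; case/setD1P: Bx.
      by rewrite !cardsU1 in_setU1 negb_or ne_jl !notBiJ // !add1n cardBi.
    move/(congr1 (fun w => dot w (pt i))); rewrite dotBl dotZl e0B // mulr0 subr0.
    by rewrite eP // eqxx dot0l => /eqP; rewrite oner_eq0.
  pose M := [set - (a j / b j) | j in J].
  have [||||m nz_m mP] := @parallel_levels (fun s r => phi (w + s *: e i + r *: e0)) M.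
  - by move=> s r r'; apply: inj_e0.
  - apply/imsetP; exists i0; first by rewrite !inE eqxx.
    by rewrite /a eP // eq_sym (negPf ne_i) mul0r oppr0.
  - move=> m s s' r r' /imsetP[j Jj ->] ne_s eq_phi; apply/eqP => eq_r.
    have : w + s *: e i + r *: e0 = w + s' *: e i + r' *: e0.
      apply: (phi_inj (A := j |: (B0 :\ i))) => //.
        move=> l /setU1P[->|Bl]; rewrite !dotDl !dotZl -/(a _) -/(b _).
          rewrite -!addrA; congr (_ + _).
          have -> : r = r' - a j / b j * (s - s') by rewrite -mulNr -eq_r addrC subrK.
          by field; apply: nz_b.
        by rewrite aBi // /b (e0B l) ?mulr0 //; case/setD1P: Bl.
      by rewrite cardsU1 notBiJ // add1n cardBi.
    move/(congr1 (fun w => dot w (pt i))); rewrite !dotDl !dotZl e0B // eP // eqxx.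
    by rewrite !mulr0 !mulr1 !addr0 => /addrI eq_s; rewrite eq_s eqxx in ne_s.
  - rewrite card_in_imset // cardsU1 !inE negbK Bi0 add1n cardsCs setCK cardB.
    by rewrite -(leq_add2r K) addSn subnK.
  exists m => _; split=> // s r; rewrite mP scale0r addr0 //.
have /fin_all_exists[m_ mP] := plane.
pose m i w := m_ (i, w).
have nz_m i w : i \in B0 -> m i w != 0 by move=> B0i; case: (mP (i, w)).
have phi_m i w s r : i \in B0 ->
    phi (w + s *: e i + (r + m i w * s) *: e0) = phi (w + r *: e0).
  by move=> B0i; case: (mP (i, w)).
have m_uniq i w c : i \in B0 ->
    (forall s, phi (w + s *: e i + (c * s) *: e0) = phi w) -> m i w = c.
  move=> B0i cP; have := phi_m i w 1 0 B0i; rewrite add0r scale0r addr0 -(cP 1).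
  by move/inj_e0; rewrite !mulr1.
have m_e0 i w r : i \in B0 -> m i (w + r *: e0) = m i w.
  move=> B0i; apply: m_uniq => // s; rewrite -(phi_m i w s r B0i).
  by rewrite scalerDl !addrA; congr (phi (_ + _)); rewrite addrAC.
have m_self i w s : i \in B0 -> m i (w + s *: e i) = m i w.
  move=> B0i; apply: m_uniq => // s'.
  have := phi_m i w (s + s') (- (m i w * s)) B0i.
  have := phi_m i w s (- (m i w * s)) B0i.
  rewrite addNr scale0r addr0 => -> <-.
  by rewrite mulrDr addKr scalerDl !addrA.
have m_other i j w s : i \in B0 -> j \in B0 -> m i (w + s *: e j) = m i w.
  move=> B0i B0j.
  (* Two moves that stay in a level set of phi. *)
  have path a b u v : a \in B0 -> b \in B0 ->
      phi (w + u *: e a + v *: e b + (m a w * u + m b (w + u *: e a) * v) *: e0) = phi w.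
    by move=> B0a B0b; rewrite phi_m // -[m a w * u]add0r phi_m // scale0r addr0.
  have swap x r : (m i (w + x *: e j) - m i w) * r = (m j (w + r *: e i) - m j w) * x.
    have := path j i x r B0j B0i; rewrite -(path i j r x B0i B0j) (addrAC w (r *: _)).
    move/inj_e0 => eq_m.
    by rewrite !mulrBl -[_ * r](addKr (m j w * x)) eq_m; ring.
  apply/eqP; rewrite -subr_eq0; apply: contraT => nz_d.
  pose c := m j (w + 1 *: e i) - m j w.
  have swap1 s' : m i (w + s' *: e j) - m i w = c * s' by rewrite -swap mulr1.
  have nz_c : c != 0 by apply: contraNneq nz_d => c0; rewrite swap1 c0 mul0r.
  have /eqP[] := nz_m i (w + (- m i w / c) *: e j) B0i.
  by apply/eqP; rewrite -(subrK (m i w) (m i _)) swap1 mulrC divfK // addNr.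
have m_const i w : i \in B0 -> m i w = m i 0.
  move=> B0i; rewrite (e_decomp w).
  apply: (big_rec (fun v => m i v = m i 0)) => // b v Bb <-; rewrite addrC.
  have [->|ne_b] := eqVneq b i0; first exact: m_e0.
  by apply: m_other; rewrite // !inE ne_b.
pose u := pt i0 - \sum_(b in B0) m b 0 *: pt b.
exists u; have inj_phi0 : injective (fun r => phi (r *: e0)).
  by move=> r r' eq_phi; apply: (inj_e0 0); rewrite !add0r.
exists (perm inj_phi0) => w; rewrite permE.
have phi_move b v s : b \in B0 -> phi (v + s *: (e b + m b 0 *: e0)) = phi v.
  move=> B0b; rewrite -(m_const b v B0b).
  have := phi_m b v s 0 B0b; rewrite add0r scale0r addr0 => <-.
  by rewrite scalerDr scalerA (mulrC s) addrA.
have def_w : w = dot w u *: e0 + \sum_(b in B0) dot w (pt b) *: (e b + m b 0 *: e0).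
  rewrite {1}(e_decomp w) (big_setD1 i0) //= dotBr dot_sumr scalerBl.
  rewrite -addrA; congr (_ + _); rewrite scaler_suml -sumrN -big_split.
  by apply: eq_bigr => b _; rewrite /= dotZr scalerDr scalerA
    [dot _ _ * _]mulrC addrC addrK.
rewrite {1}def_w; elim/big_rec: _ => [|b v B0b IH]; first by rewrite addr0.
by rewrite addrCA addrC phi_move.
Qed.

End ExtraColumn.
End ParallelLevels.

(** * Codes described by a family of points and alphabet permutations *)

Section Equivalence.
Variable A : finType.

(** Permuting the alphabets of the columns listed in l one at a time. *)
Lemma equivalent_alphabets n (W : {set 'rV[A]_n}) (p : 'I_n -> {perm A}) (l : seq 'I_n) :
  uniq l -> equivalent (Code W)
    (Code [set \row_j (if j \in l then p j (w ord0 j) else w ord0 j) | w : 'rV[A]_n in W]).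
Proof.
elim: l => [|i l IH] /=.
  move=> _; rewrite (_ : [set _ | w : 'rV[A]_n in W] = W); first exact: rt_refl.
  by rewrite -[RHS]imset_id; apply: eq_imset => w; apply/rowP => j; rewrite mxE.
case/andP => notli /IH eqvW; apply: (rt_trans _ _ _ _ _ eqvW).
apply: rt_step; set W' := [set _ | w : 'rV[A]_n in W].
have -> : [set \row_j (if j \in i :: l then p j (w ord0 j) else w ord0 j)
      | w : 'rV[A]_n in W] =
    [set permute_entry i (p i) w | w in W'].
  rewrite -imset_comp; apply: eq_imset => w; apply/rowP => j; rewrite !mxE inE.
  by have [->|//] := eqVneq j i; rewrite (negPf notli).
exact: permute_alphabet.
Qed.

Lemma equivalent_columns n (W : {set 'rV[A]_n}) (s : 'S_n) (p : 'I_n -> {perm A}) :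
  equivalent (Code W) (Code [set \row_j p j (w ord0 (s j)) | w : 'rV[A]_n in W]).
Proof.
apply: (rt_trans _ _ _ _ _ (rt_step _ _ _ _ (permute_columns W s))).
rewrite (_ : [set \row_j p j (w ord0 (s j)) | w : 'rV[A]_n in W] =
  [set \row_j (if j \in enum 'I_n then p j (w ord0 j) else w ord0 j)
     | w : 'rV[A]_n in [set col_perm s w | w : 'rV[A]_n in W]]); 
  first by apply: equivalent_alphabets; apply: enum_uniq.
rewrite -imset_comp; apply: eq_imset => w; apply/rowP => j.
by rewrite !mxE mem_enum.
Qed.

End Equivalence.

Section Coded.
Variables (F : finFieldType) (K : nat).
Local Notation q := #|F|.

Definition codeword m (pt : 'I_m -> 'cV[F]_K) (p : 'I_m -> {perm F}) (w : 'rV[F]_K) :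
  'rV[F]_m := \row_j p j (dot w (pt j)).

Definition coded m (pt : 'I_m -> 'cV[F]_K) (p : 'I_m -> {perm F}) : {set 'rV[F]_m} :=
  [set codeword pt p w | w in 'rV[F]_K].

Lemma agree_codeword m (pt : 'I_m -> 'cV[F]_K) p w w' :
  agree (codeword pt p w) (codeword pt p w') = zeros pt setT (w - w').
Proof.
by apply/setP => j; rewrite !inE !mxE (inj_eq perm_inj) dotBl subr_eq0.
Qed.

Lemma coded_arc m (pt : 'I_m -> 'cV[F]_K) p :
  is_MDS m K q (Code (coded pt p)) -> injective (codeword pt p) /\ arc pt setT.
Proof.
case=> _ _ /= cardW mds.
have inj : injective (codeword pt p).
  have /imset_injP inj : #|coded pt p| == #|'rV[F]_K|.
    by rewrite cardW card_mx mul1n.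
  by move=> w w'; apply: inj.
split=> // w nz_w; rewrite -[w]subr0 -(agree_codeword _ p) ltnNge.
by apply: mds; rewrite ?imset_f // (inj_eq inj).
Qed.

Lemma arc_coded m (pt : 'I_m -> 'cV[F]_K) p :
  (K <= m)%N -> arc pt setT -> is_MDS m K q (Code (coded pt p)).
Proof.
move=> leKm arc_pt.
have agree_lt w w' : w != w' -> (#|agree (codeword pt p w) (codeword pt p w')| < K)%N.
  by rewrite -subr_eq0 agree_codeword => /arc_pt.
have inj : injective (codeword pt p).
  move=> w w' eq_w; apply/eqP; apply: contraLR leKm => /agree_lt.
  rewrite eq_w -ltnNge (_ : agree _ _ = setT) ?cardsT ?card_ord //.
  by apply/setP => j; rewrite !inE eqxx.
split=> //=; first by rewrite card_imset // card_mx mul1n.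
move=> _ _ /imsetP[w _ ->] /imsetP[w' _ ->] ne_w; rewrite -ltnNge agree_lt //.
by apply: contraNneq ne_w => ->.
Qed.

Lemma coded_LE m (pt : 'I_m -> 'cV[F]_K) p :
  (K <= m)%N -> arc pt setT -> is_LE K q (Code (coded pt p)).
Proof.
move=> leKm arc_pt; exists (Code (coded pt (fun=> 1%g))); split; last first.
  suff -> : coded pt p =
      [set \row_j p j (w ord0 ((1%g : 'S_m) j)) | w : 'rV[F]_m in coded pt (fun=> 1%g)].
    exact: equivalent_columns.
  rewrite -imset_comp; apply: eq_imset => w; apply/rowP => j.
  by rewrite !mxE !perm1.
split; first exact: arc_coded.
pose G : 'M[F]_(K, m) := \matrix_(i, j) pt j i ord0.
have def_G w : codeword pt (fun=> 1%g) w = w *m G.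
  apply/rowP => j; rewrite !mxE perm1 /dot mxE.
  by apply: eq_bigr => i _; rewrite !mxE.
pose f := linfun (mulmxr G : 'rV[F]_K -> 'rV[F]_m).
exists (limg f); split.
  have ker0 : (fullv :&: lker f)%VS = 0%VS.
    rewrite capfv; apply/eqP/lker0P => w w'; rewrite !lfunE /= -!def_G.
    exact: (coded_arc (arc_coded _ leKm arc_pt)).1.
  by rewrite limg_dim_eq // dimvf /dim /= mul1n.
apply/setP => v; rewrite inE; apply/imsetP/memv_imgP => [[w _ ->]|[w _ ->]].
  by exists w; rewrite ?memvf // lfunE /= def_G.
by exists w => //; rewrite lfunE /= def_G.
Qed.

Lemma arc_interpolation (T : finType) (pt : T -> 'cV[F]_K) (A : {set T}) (g : T -> F) :
  arc pt setT -> #|A| = K -> exists w, {in A, forall j, dot w (pt j) = g j}.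
Proof.
move=> arc_pt cardA.
have [||w wP] := @interpolation F K {j | j \in A} (fun j => pt (val j)) (fun j => g (val j)).
- by rewrite card_sig cardA.
- move=> w w0; apply: (arc_zero arc_pt (A := A)); rewrite ?subsetT ?cardA //.
  by move=> j Aj; apply: (w0 (exist _ j Aj)).
by exists w => j Aj; apply: (wP (exist _ j Aj)).
Qed.

(** Some w vanishes at j but not at i. *)
Lemma arc_not_proportional (T : finType) (pt : T -> 'cV[F]_K) i j a :
  arc pt setT -> (1 < K <= #|T|)%N -> i != j -> pt i != a *: pt j.
Proof.
move=> arc_pt /andP[K_gt1 leKT] ne_ij; apply/eqP => eq_ij.
have [A [Ai Aj cardA]] : exists A : {set T}, [/\ i \in A, j \in A & #|A| = K].
  pose r := enum (~: [set i; j]).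
  have size_r : (size r = #|T| - 2)%N.
    by rewrite -cardE cardsCs setCK cards2 ne_ij.
  have uniq_r : uniq (take (K - 2) r) by rewrite take_uniq ?enum_uniq.
  have notr x : x \in [set i; j] -> x \notin take (K - 2) r.
    by move=> xij; apply/negP => /mem_take; rewrite mem_enum inE xij.
  exists [set x in [:: i, j & take (K - 2) r]]; rewrite !inE !eqxx orbT; split=> //.
  rewrite cardsE; have /card_uniqP -> : uniq [:: i, j & take (K - 2) r].
    by rewrite /= inE negb_or ne_ij !notr ?inE ?eqxx ?orbT.
  by rewrite /= size_takel ?size_r ?leq_sub2r // -[RHS](subnK K_gt1) addn2.
have [w wP] := arc_interpolation (fun x => (x == i)%:R) arc_pt cardA.
have := congr1 (dot w) eq_ij; rewrite dotZr !wP // eqxx eq_sym (negPf ne_ij).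
by rewrite mulr0 => /eqP; rewrite oner_eq0.
Qed.

Lemma arc_neq0 (T : finType) (pt : T -> 'cV[F]_K) i :
  arc pt setT -> (1 < K <= #|T|)%N -> pt i != 0.
Proof.
move=> arc_pt K_range; have /andP[/leq_trans gt1 /gt1] := K_range.
case/card_gt1P=> x [y [_ _ ne_xy]].
have [l ne_il] : exists l, i != l.
  by have [->|ne_ix] := eqVneq i x; [exists y | exists x].
by have := arc_not_proportional 0 arc_pt K_range ne_il; rewrite scale0r.
Qed.

Lemma arc_length m (pt : 'I_m -> 'cV[F]_K) :
  arc pt setT -> (1 < K <= m)%N -> (m <= #|'cV[F]_K|)%N.
Proof.
move=> arc_pt K_range; rewrite -[m in (m <= _)%N]card_ord.
apply: (leq_card pt) => i j eq_ij; apply/eqP; apply: contraT => ne_ij.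
have := arc_not_proportional 1 arc_pt _ ne_ij; rewrite card_ord scale1r eq_ij eqxx.
by move=> /(_ K_range).
Qed.

(** The zeros of w at the kept columns and at column j are distinct zeros of w in
    the arc pt'. *)
Lemma extends_column m m' (pt : 'I_m -> 'cV[F]_K) (pt' : 'I_m' -> 'cV[F]_K) keep j :
  injective keep -> (forall i, pt' (keep i) = pt i) -> j \notin codom keep ->
  arc pt' setT -> extends pt setT (pt' j).
Proof.
move=> inj_keep ptK not_keep arc_pt' w /arc_pt'; apply: leq_ltn_trans.
rewrite -(card_imset _ inj_keep); set I := keep @: _.
have notI : j \notin I by apply: contra not_keep => /imsetP[i _ ->]; apply: codom_f.
have sub : I \subset zeros pt' setT w.
  by apply/subsetP => _ /imsetP[i + ->]; rewrite !inE ptK.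
have [wj|_] := eqVneq (dot w (pt' j)) 0; last by rewrite addn0 subset_leq_card.
rewrite addnC (_ : (true + #|I|)%N = #|j |: I|); last by rewrite cardsU1 notI.
by apply: subset_leq_card; rewrite subUset sub1set sub !inE wj eqxx.
Qed.

Lemma card_zerosU1 (T : finType) (pt : T -> 'cV[F]_K) (J : {set T}) b w : b \notin J ->
  #|zeros pt (b |: J) w| = (#|zeros pt J w| + (dot w (pt b) == 0%R))%N.
Proof.
move=> notJb; have notZ : b \notin zeros pt J w by rewrite inE (negPf notJb).
have [wb|nz_wb] := eqVneq (dot w (pt b)) 0.
  have -> : zeros pt (b |: J) w = b |: zeros pt J w.
    by apply/setP => j; rewrite !inE; have [->|] := eqVneq j b; rewrite ?wb ?eqxx.
  by rewrite cardsU1 notZ addnC.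
rewrite addn0; congr #|pred_of_set _|; apply/setP => j; rewrite !inE.
by have [->|//] := eqVneq j b; rewrite (negPf nz_wb) !andbF.
Qed.

(** The new column comes last, so that the old ones keep their order. *)
Definition append (R : Type) m (f : 'I_m -> R) (x : R) (j : 'I_m.+1) : R :=
  if unlift ord_max j is Some i then f i else x.

Lemma append_lift (R : Type) m (f : 'I_m -> R) x i : append f x (lift ord_max i) = f i.
Proof. by rewrite /append liftK. Qed.

Lemma append_max (R : Type) m (f : 'I_m -> R) x : append f x ord_max = x.
Proof. by rewrite /append unlift_none. Qed.

Lemma arc_append m (pt : 'I_m -> 'cV[F]_K) u :
  extends pt setT u -> arc (append pt u) setT.
Proof.
move=> ext_u w /ext_u; apply: leq_ltn_trans.
pose I := lift ord_max @: [set: 'I_m].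
have notI : ord_max \notin I.
  by apply/imsetP => -[i _ /eqP]; apply/negP; apply: neq_lift.
have -> : [set: 'I_m.+1] = ord_max |: I.
  apply/setP => j; rewrite inE; case: (unliftP ord_max j) => [i|] ->; rewrite !inE ?eqxx //.
  by rewrite imset_f ?orbT.
rewrite card_zerosU1 // append_max leq_add2r -[leqRHS](card_imset _ (lift_inj (h := ord_max))).
apply/subset_leq_card/subsetP => j; rewrite inE => /andP[/imsetP[i _ ->]].
by rewrite append_lift => wi; rewrite imset_f // !inE wi.
Qed.

Lemma extension_append m (pt : 'I_m -> 'cV[F]_K) (p : 'I_m -> {perm F}) u :
  (K <= m)%N -> extends pt setT u ->
  extension K q (Code (coded (append pt u) (append p 1%g))) (Code (coded pt p)).
Proof.
move=> leKm ext_u; split=> //=.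
- by apply: arc_coded leKm (extends_arc ext_u).
- by apply: arc_coded (arc_append ext_u); apply: leqW.
exists (lift ord_max); split.
  by move=> i j; rewrite !lift_max.
rewrite /coded -imset_comp; apply: eq_imset => w; apply/rowP => j.
by rewrite !mxE !append_lift.
Qed.

End Coded.

Lemma linear_generator (F : finFieldType) k n q (C : code F) :
  is_linear_MDS n k q C ->
  exists pt : 'I_(len C) -> 'cV[F]_k, words C = coded pt (fun=> 1%g).
Proof.
case=> _ [U [dimU def_C]]; case: {k} _ / dimU.
pose b := vbasis U; pose pt j : 'cV[F]_(\dim U) := \col_i b`_i ord0 j.
have def_dot w : codeword pt (fun=> 1%g) w = \sum_i w ord0 i *: b`_i.
  apply/rowP => j; rewrite mxE perm1 /dot mxE summxE.
  by apply: eq_bigr => i _; rewrite !mxE.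
exists pt; apply/setP => v; rewrite def_C inE; apply/idP/imsetP => [Uv|[w _ ->]].
  exists (\row_i coord b i v) => //; rewrite def_dot {1}(coord_vbasis Uv).
  by apply: eq_bigr => i _; rewrite mxE.
rewrite def_dot; apply: memv_suml => i _; apply/memvZ/vbasis_mem.
by rewrite mem_nth // size_tuple.
Qed.

Lemma increasing_inj m m' (keep : 'I_m -> 'I_m') :
  (forall i j : 'I_m, (i < j)%N -> (keep i < keep j)%N) -> injective keep.
Proof.
by move=> mono i j eq_k; apply: val_inj; have [/mono|/mono|//] := ltngtP i j;
  rewrite eq_k ltnn.
Qed.

Section LargeCodes.
Variables (F : finFieldType) (h t K n : nat).
Local Notation q := #|F|.
Hypotheses (cardF : q = (2 ^ h)%N) (ht : largest_proper_divisor h t)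
  (K_gt1 : (1 < K)%N) (leKn : (K <= n)%N) (leqn : (q - 2 ^ (h - t) + K <= n.+1)%N).

(** A word of D is determined by the kept coordinates, so each of its coordinates
    is a function of the parameter w, and [extra_column_linear] applies to those
    that are not kept.  The alphabet permutations p do not affect the agreement
    sets, so the smaller code need only be linear up to such permutations. *)
Lemma extension_coded m (pt : 'I_m -> 'cV[F]_K) p (D : code F)
    (keep : 'I_m -> 'I_(len D)) : (n <= m)%N -> injective keep ->
  coded pt p = [set colsub keep w | w in words D] ->
  is_MDS m K q (Code (coded pt p)) -> is_MDS (len D) K q D ->
  exists ptD : 'I_(len D) -> 'cV[F]_K, exists pD,
    [/\ words D = coded ptD pD, forall i, ptD (keep i) = pt i
      & forall i, pD (keep i) = p i].
Proof.
move=> le_nm inj_keep def_C mdsC mdsD.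
have [inj_c arc_pt] := coded_arc mdsC.
have [d dP] : exists d : 'rV[F]_K -> 'rV[F]_(len D),
    forall w, d w \in words D /\ colsub keep (d w) = codeword pt p w.
  have /fin_all_exists[d dP] w : exists v, v \in words D /\ colsub keep v = codeword pt p w.
    have : codeword pt p w \in coded pt p by apply: imset_f.
    by rewrite def_C => /imsetP[v Dv ->]; exists v.
  by exists d.
have inj_d : injective d.
  by move=> w w' eq_d; apply: inj_c; rewrite -(dP w).2 -(dP w').2 eq_d.
have def_D : words D = [set d w | w in 'rV[F]_K].
  apply/eqP; rewrite eq_sym eqEcard; apply/andP; split.
    by apply/subsetP => _ /imsetP[w _ ->]; case: (dP w).
  by rewrite card_imset // card_mx mul1n; case: mdsD => _ _ ->.
have d_keep w i : d w ord0 (keep i) = p i (dot w (pt i)).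
  by have /rowP/(_ i) := (dP w).2; rewrite !mxE.
have col j : exists u, exists pj : {perm F}, (forall w, d w ord0 j = pj (dot w u)) /\
    (forall i, j = keep i -> u = pt i /\ pj = p i).
  have [/codomP[i def_j]|not_keep] := boolP (j \in codom keep).
    exists (pt i), (p i); split=> [w|i' def_j']; first by rewrite def_j d_keep.
    by have -> : i = i' by apply: inj_keep; rewrite -def_j.
  have [||w w' ne_w|u [pj pjP]] := @extra_column_linear F h t cardF ht K _ pt
    (fun w => d w ord0 j) K_gt1.
  - by rewrite card_ord (leq_trans leKn).
  - by rewrite card_ord (leq_trans leqn).
  - have : (#|agree (d w) (d w')| < K)%N.
      rewrite ltnNge; case: mdsD => _ _ _; apply; rewrite ?(dP _).1 //.
      by rewrite (inj_eq inj_d).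
    apply: leq_ltn_trans.
    rewrite -(card_imset _ inj_keep); set I := keep @: _.
    have notI : j \notin I.
      by apply: contra not_keep => /imsetP[i _ ->]; apply: codom_f.
    apply: (@leq_trans #|if d w ord0 j == d w' ord0 j then j |: I else I|).
      by case: ifP => _; rewrite ?cardsU1 ?notI ?addn0 // addnC.
    apply/subset_leq_card/subsetP => l.
    have sub : l \in I -> l \in agree (d w) (d w').
      by case/imsetP => i; rewrite inE => /eqP eq_i ->; rewrite inE !d_keep eq_i.
    case: ifP => eq_j; last exact: sub.
    by case/setU1P => [->|/sub //]; rewrite inE.
  exists u, pj; split=> // i def_j.
  by move: not_keep; rewrite def_j codom_f.
have /fin_all_exists[ptD /fin_all_exists[pD ptP]] := col.
exists ptD, pD; split=> [|i|i]; last 2 first.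
- by case: (ptP (keep i)) => _ /(_ i erefl)[].
- by case: (ptP (keep i)) => _ /(_ i erefl)[].
rewrite def_D; apply: eq_imset => w; apply/rowP => j; rewrite mxE.
by case: (ptP j).
Qed.

Lemma maximal_coded m (pt : 'I_m -> 'cV[F]_K) p : (n <= m)%N ->
  is_MDS m K q (Code (coded pt p)) -> (forall u, ~ extends pt setT u) ->
  maximal K q (Code (coded pt p)).
Proof.
move=> le_nm mdsC no_ext; split=> // -[m' W] [_ mdsD /= lt_mm' [keep [keep_mono defC]]].
have inj_keep := increasing_inj keep_mono.
have [pt' [p' [def_W ptK _]]] :=
  extension_coded (D := Code W) le_nm inj_keep defC mdsC mdsD.
have [j not_keep] : exists j, j \notin codom keep.
  apply/existsP; rewrite -negb_forall; apply: contraL lt_mm' => /forallP all_in.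
  rewrite -leqNgt -[m']card_ord -[m in (_ <= m)%N]card_ord -(card_codom inj_keep).
  by apply/subset_leq_card/subsetP => j _; apply: all_in.
rewrite /= in def_W mdsD; rewrite def_W in mdsD.
exact: no_ext (extends_column inj_keep ptK not_keep (coded_arc mdsD).2).
Qed.

(** If the point pt' j were new, it could be joined to the points of pt one at a
    time, starting from the common points pt0, by [extends_pair]; at the end it
    would extend pt. *)
Lemma proportional_column m m' (pt0 : 'I_n -> 'cV[F]_K) (pt : 'I_m -> 'cV[F]_K)
    (pt' : 'I_m' -> 'cV[F]_K) keep keep' :
  injective keep -> injective keep' ->
  (forall i, pt (keep i) = pt0 i) -> (forall i, pt' (keep' i) = pt0 i) ->
  arc pt setT -> arc pt' setT -> (forall u, ~ extends pt setT u) ->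
  forall j, exists i a, pt' j = a *: pt i.
Proof.
move=> inj_k inj_k' ptK ptK' arc_pt arc_pt' no_ext j.
have [/existsP[i /existsP[a /eqP eq_j]]|] :=
  boolP [exists i, exists a, pt' j == a *: pt i]; first by exists i, a.
rewrite negb_exists => /forallP none; case: (no_ext (pt' j)).
have not_prop i a : pt' j != a *: pt i.
  by have := none i; rewrite negb_exists => /forallP/(_ a).
have le_nm : (n <= m)%N by rewrite -[n]card_ord -[m]card_ord (leq_card keep).
have not_prop' i a : pt i != a *: pt' j.
  have [->|nz_a] := eqVneq a 0.
    by rewrite scale0r arc_neq0 // card_ord K_gt1 (leq_trans leKn).
  apply: contraNneq (not_prop i a^-1) => ->.
  by rewrite scalerA mulVf ?scale1r.
pose J (l : seq 'I_m) := keep @: setT :|: [set x in l].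
suff ext_J l : extends pt (J l) (pt' j).
  have -> : setT = J (enum 'I_m); last exact: ext_J.
  by apply/setP => x; rewrite !inE mem_enum orbT.
elim: l => [|b l IH].
  have not_k : j \notin codom keep'.
    apply/codomP => -[i def_j]; have := not_prop (keep i) 1.
    by rewrite scale1r ptK def_j ptK' eqxx.
  move=> w nz_w; have := extends_column inj_k' ptK' not_k arc_pt' nz_w.
  apply: leq_ltn_trans; rewrite leq_add2r -[leqRHS](card_imset _ inj_k).
  apply/subset_leq_card/subsetP => x; rewrite !inE orbF => /andP[/imsetP[i _ ->]].
  by rewrite ptK => wi; rewrite imset_f // !inE.
have -> : J (b :: l) = b |: J l by apply/setP => x; rewrite !inE orbCA.
have [Jb|notJb] := boolP (b \in J l).
  by rewrite (setUidPr _) // sub1set.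
have le_nJ : (n <= #|J l|)%N.
  rewrite -[n]card_ord -cardsT -(card_imset _ inj_k).
  by rewrite subset_leq_card // subsetUl.
have extb : extends pt (J l) (pt b).
  move=> w /arc_pt; apply: leq_ltn_trans; rewrite -card_zerosU1 //.
  by apply/subset_leq_card/subsetP => x; rewrite !inE => /andP[].
move=> w nz_w; rewrite card_zerosU1 // addnAC.
apply: (extends_pair (pchar2 cardF) _ IH extb _ nz_w) => [|a]; last exact: not_prop'.
have lt_h := largest_proper_divisor_subn ht.
have : (2 * 2 ^ (h - t) <= q)%N by rewrite -expnS cardF leq_exp2l.
move: leqn le_nJ; move: (2 ^ (h - t))%N #|J l| #|F| => X Y Q; lia.
Qed.

End LargeCodes.

(** The scalars a i are absorbed in the alphabet permutations.  The lengths are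
    kept as separate variables because the equality m = m' arises from a
    counting argument. *)
Lemma equivalent_coded (F : finFieldType) K m m' (pt : 'I_m -> 'cV[F]_K) p
    (pt' : 'I_m' -> 'cV[F]_K) p' (s : 'I_m -> 'I_m') (a : 'I_m -> F) :
  m = m' -> injective s -> (forall i, a i != 0) -> (forall i, pt i = a i *: pt' (s i)) ->
  equivalent (Code (coded pt' p')) (Code (coded pt p)).
Proof.
move=> eq_m; subst m'; move=> inj_s nz_a ptE.
have inj_r i : injective (fun x => p i (a i * (p' (s i))^-1%g x)).
  by move=> x y /perm_inj /(mulfI (nz_a i)) /perm_inj.
suff -> : coded pt p =
    [set \row_i perm (inj_r i) (w ord0 (perm inj_s i)) | w : 'rV[F]_m in coded pt' p'].
  exact: equivalent_columns.
rewrite /coded -imset_comp; apply: eq_imset => w; apply/rowP => i.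
by rewrite !mxE (permE (inj_r i)) (permE inj_s) permK ptE dotZr.
Qed.

(** * The code and its extensions *)

Section Members.
Variables (F : finFieldType) (h t K : nat) (C : code F) (pt0 : 'I_(len C) -> 'cV[F]_K).
Local Notation q := #|F|.
Local Notation n := (len C).
Hypotheses (cardF : q = (2 ^ h)%N) (ht : largest_proper_divisor h t)
  (K_gt1 : (1 < K)%N) (leKn : (K <= n)%N) (leqn : (q - 2 ^ (h - t) + K <= n.+1)%N)
  (mdsC : is_MDS n K q C) (def_C : words C = coded pt0 (fun=> 1%g)).

(** D is given by points that include those of C, unpermuted, at the positions
    selected by keep. *)
Definition coded_over (D : code F) (pt : 'I_(len D) -> 'cV[F]_K)
    (p : 'I_(len D) -> {perm F}) (keep : 'I_n -> 'I_(len D)) :=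
  [/\ words D = coded pt p, forall i j : 'I_n, (i < j)%N -> (keep i < keep j)%N,
      forall i, pt (keep i) = pt0 i & forall i, p (keep i) = 1%g].

Lemma member_coded D : self_or_extension K q C D ->
  is_MDS (len D) K q D /\ exists pt p keep, @coded_over D pt p keep.
Proof.
case=> [->|[_ mdsD lt_CD [keep [keep_mono def_CD]]]].
  by split=> //; exists pt0, (fun=> 1%g), id; split.
split=> //; have inj_keep := increasing_inj keep_mono.
have mdsC' : is_MDS n K q (Code (coded pt0 (fun=> 1%g))).
  by case: (C) pt0 mdsC def_C => m W pt /= mds <-.
have def_CD' : coded pt0 (fun=> 1%g) = [set colsub keep w | w in words D].
  by rewrite -def_C.
have [pt [p [def_D ptK pK]]] := extension_coded cardF ht K_gt1 leKn leqn
  (leqnn _) inj_keep def_CD' mdsC' mdsD.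
by exists pt, p, keep; split.
Qed.

Lemma coded_extension D pt p keep : @coded_over D pt p keep ->
  is_MDS (len D) K q D -> (n < len D)%N -> extension K q D C.
Proof.
case=> def_D keep_mono ptK pK mdsD lt_CD; split=> //; exists keep; split=> //.
rewrite def_C def_D /coded -imset_comp; apply: eq_imset => w; apply/rowP => i.
by rewrite !mxE ptK pK.
Qed.

Lemma member_LE D : self_or_extension K q C D -> is_LE K q D.
Proof.
case/member_coded; case: D => m W /= mdsD [pt [p [keep [/= def_W keep_mono _ _]]]].
rewrite def_W in mdsD *; apply: coded_LE (coded_arc mdsD).2.
rewrite (leq_trans leKn) // -[n]card_ord -[m]card_ord.
exact: leq_card (increasing_inj keep_mono).
Qed.

Lemma maximal_no_extends m (pt : 'I_m -> 'cV[F]_K) p u : (K <= m)%N ->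
  maximal K q (Code (coded pt p)) -> ~ extends pt setT u.
Proof. by move=> leKm [_ maxM] /(extension_append p leKm)/maxM. Qed.

(** Columns are appended as long as some vector extends the arc; distinct columns
    of an arc are distinct vectors, so the length is bounded. *)
Lemma exists_maximal_member :
  exists2 M, self_or_extension K q C M & maximal K q M.
Proof.
suff step d : forall D, self_or_extension K q C D ->
    (#|'cV[F]_K| - len D < d)%N -> exists2 M, self_or_extension K q C M & maximal K q M.
  by apply: (step _ C) (ltnSn _); left.
elim: d => // d IH D SD lt_d; have [mdsD [pt [p [keep cD]]]] := member_coded SD.
case: D SD lt_d mdsD pt p keep cD => m W SD /= lt_d mdsD pt p keep cD.
have [/= def_W keep_mono ptK pK] := cD; rewrite def_W in SD mdsD.
have le_nm : (n <= m)%N.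
  by rewrite -[n]card_ord -[m]card_ord (leq_card _ (increasing_inj keep_mono)).
have leKm := leq_trans leKn le_nm; have arc_pt := (coded_arc mdsD).2.
pose extb u := [forall w, (w != 0) ==> (#|zeros pt setT w| + (dot w u == 0%R) < K)%N].
have [/existsP[u /forallP ext_u]|no_ext] := boolP [exists u, extb u]; last first.
  exists (Code (coded pt p)) => //.
  apply: (maximal_coded cardF ht K_gt1 leKn leqn le_nm mdsD) => u ext_u.
  case/existsP: no_ext; exists u; apply/forallP => w; apply/implyP; exact: ext_u.
have {}ext_u : extends pt setT u by move=> w nz_w; have := ext_u w; rewrite nz_w.
have [_ mdsM _ _] := extension_append p leKm ext_u.
apply: (IH (Code (coded (append pt u) (append p 1%g)))) => /=.
  right; apply: (@coded_extension (Code (coded (append pt u) (append p 1%g)))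
    (append pt u) (append p 1%g) (lift ord_max \o keep)) => //.
  split=> // [i j lt_ij|i|i]; first by rewrite /comp !lift_max keep_mono.
    by rewrite /= append_lift ptK.
  by rewrite /= append_lift pK.
have := arc_length (arc_append ext_u); rewrite K_gt1 leqW // => /(_ isT); lia.
Qed.

(** Each column of either code is proportional to a column of the other one, and
    columns of one code are pairwise nonproportional, so proportionality is a
    bijection between the two sets of columns. *)
Lemma maximal_member_unique M M' :
  self_or_extension K q C M -> maximal K q M ->
  self_or_extension K q C M' -> maximal K q M' -> equivalent M' M.
Proof.
case/member_coded; case: M => m W mdsM /= [pt [p [k [/= def_W k_mono ptK _]]]].
move=> maxM.
case/member_coded.
case: M' => m' W' mdsM' /= [pt' [p' [k' [/= def_W' k_mono' ptK' _]]]] maxM'.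
rewrite def_W in mdsM maxM *; rewrite def_W' in mdsM' maxM' *.
have inj_k := increasing_inj k_mono; have inj_k' := increasing_inj k_mono'.
have arc_pt := (coded_arc mdsM).2; have arc_pt' := (coded_arc mdsM').2.
have leKm : (K <= m)%N.
  by rewrite (leq_trans leKn) // -[n]card_ord -[m]card_ord (leq_card k).
have leKm' : (K <= m')%N.
  by rewrite (leq_trans leKn) // -[n]card_ord -[m']card_ord (leq_card k').
have no_ext u := maximal_no_extends (u := u) leKm maxM.
have no_ext' u := maximal_no_extends (u := u) leKm' maxM'.
have /fin_all_exists[s /fin_all_exists[a sP]] :=
  proportional_column cardF ht K_gt1 leKn leqn
    inj_k' inj_k ptK' ptK arc_pt' arc_pt no_ext'.
have /fin_all_exists[s' /fin_all_exists[a' sP']] :=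
  proportional_column cardF ht K_gt1 leKn leqn
    inj_k inj_k' ptK ptK' arc_pt arc_pt' no_ext.
have inj_col r (ptr : 'I_r -> 'cV[F]_K) r' (ptr' : 'I_r' -> 'cV[F]_K)
    (f : 'I_r -> 'I_r') b :
    arc ptr setT -> (K <= r)%N -> (forall i, ptr i = b i *: ptr' (f i)) ->
    injective f /\ forall i, b i != 0.
  move=> arc_r leKr fP.
  have nz_b i : b i != 0.
    have := @arc_neq0 F K _ ptr i arc_r; rewrite card_ord K_gt1 leKr fP => /(_ isT).
    by apply: contraNneq => ->; rewrite scale0r.
  split=> // i j eq_f; apply/eqP; apply: contraT => ne_ij.
  have := arc_not_proportional (b i / b j) arc_r _ ne_ij; rewrite card_ord K_gt1 leKr.
  by rewrite [ptr j]fP scalerA divfK // -eq_f -fP eqxx => /(_ isT).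
have [inj_s nz_a] := inj_col _ _ _ _ _ _ arc_pt leKm sP.
have [inj_s' _] := inj_col _ _ _ _ _ _ arc_pt' leKm' sP'.
have eq_m : m = m'.
  apply/eqP; rewrite eqn_leq -[m]card_ord -[m']card_ord.
  by rewrite (leq_card s) ?(leq_card s').
exact: equivalent_coded eq_m inj_s nz_a sP.
Qed.

End Members.

Local Close Scope ring_scope.

Theorem theorem7p3 (F : finFieldType) (q h t n k : nat) (C : code F)
  (hk : 1 <= k)
  (hq : q = 2 ^ h)
  (ht : largest_proper_divisor h t)
  (hC : is_linear_MDS n k.+1 q C)
  (hn : q - 2 ^ (h - t) + k - 1 < n) :
  (forall D : code F, self_or_extension k.+1 q C D -> is_LE k.+1 q D) /\
  (exists M : code F,
     [/\ self_or_extension k.+1 q C M, maximal k.+1 q M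
       & forall M' : code F, self_or_extension k.+1 q C M' ->
           maximal k.+1 q M' -> equivalent M' M]).
Proof.
have [[cardF len_C _ _] _] := hC; subst q; subst n.
have [pt0 def_C] := linear_generator hC; have [mdsC _] := hC.
have lt_h := largest_proper_divisor_subn ht.
have T2 : (2 ^ (h - t) < 2 ^ h)%N by rewrite ltn_exp2l.
have leKn : (k.+1 <= len C)%N by move: hn T2; move: (2 ^ _)%N (2 ^ _)%N; lia.
have leqn : (2 ^ h - 2 ^ (h - t) + k.+1 <= (len C).+1)%N.
  by move: hn T2; move: (2 ^ _)%N (2 ^ _)%N; lia.
rewrite -cardF in mdsC leqn *; have K_gt1 : (1 < k.+1)%N by [].
split=> [D|]; first exact: (member_LE cardF ht K_gt1 leKn leqn mdsC def_C).
have [M SM maxM] := exists_maximal_member cardF ht K_gt1 leKn leqn mdsC def_C.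
exists M; split=> // M' SM' maxM'.
exact: (maximal_member_unique cardF ht K_gt1 leKn leqn mdsC def_C).
Qed.
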